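(* Let $\mathcal K$ be the simplicial complex $(\partial\Delta^2*\partial\Delta^2)\cup\Delta^2\cup\Delta^2$ on six vertices, that is, $\mathcal K=(\partial\Delta(1,2,3)*\partial\Delta(4,5,6))\cup\Delta(1,2,3)\cup\Delta(4,5,6)$. Then the moment-angle complex $\mathcal Z_{\mathcal K}$ is homotopy equivalent to a wedge of spheres.
   Context: $\Delta(a,b,c)$ denotes the full simplex on the vertices $a,b,c$ and $\partial\Delta(a,b,c)$ its boundary; $*$ denotes the join of simplicial complexes, $\mathcal A*\mathcal B=\{A\cup B: A\in\mathcal A,B\in\mathcal B\}$. For a simplicial complex $\mathcal K$ on $\{1,\dots,m\}$, the moment-angle complex is $\mathcal Z_{\mathcal K}=\bigcup_{I\in\mathcal K}\{(x_1,\dots,x_m)\in (D^2)^m : x_j\in S^1 \text{ for } j\notin I\}$, where $D^2$ is the unit disc with boundary circle $S^1$. *)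

(* Defs.v *)
From HB Require Import structures.
From mathcomp Require Import all_boot all_order all_algebra.
From mathcomp Require Import all_classical all_reals all_analysis.
From mathcomp Require Import wedge_sigT.
Set Implicit Arguments.
Unset Strict Implicit.
Unset Printing Implicit Defensive.

Import Order.TTheory GRing.Theory Num.Theory.
Import numFieldNormedType.Exports.

Local Open Scope classical_set_scope.
Local Open Scope ring_scope.

Section SimplicialComplexes.
Context {V : finType}.
Implicit Types (K L : {set {set V}}) (S : {set V}).

(* Not every vertex of V is required to span a simplex (ghost vertices). *)
Definition simplicial_complex K : Prop :=
  finset.set0 \in K /\
  forall A B : {set V}, A \subset B -> B \in K -> A \in K.

Definition full_simplex S : {set {set V}} := powerset S.

Definition simplex_boundary S : {set {set V}} := (powerset S :\ S)%SET.

Definition join K L : {set {set V}} :=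
  [set (A :|: B)%SET | A in K, B in L]%SET.

Lemma full_simplex_complex S : simplicial_complex (full_simplex S).
Proof.
split; first by rewrite powersetE finset.sub0set.
by move=> A B AB; rewrite !powersetE; exact: fintype.subset_trans.
Qed.

Lemma simplex_boundary_complex S :
  S != finset.set0 -> simplicial_complex (simplex_boundary S).
Proof.
move=> S0; split; first by rewrite !inE eq_sym S0 finset.sub0set.
move=> A B AB; rewrite !inE => /andP[BS sBS].
rewrite (fintype.subset_trans AB sBS) andbT; apply: contra BS => /eqP AS.
by rewrite finset.eqEsubset sBS -AS.
Qed.

Lemma join_complex K L :
  simplicial_complex K -> simplicial_complex L -> simplicial_complex (join K L).
Proof.
move=> [K0 Kd] [L0 Ld]; split.
  by apply/imset2P; exists finset.set0 finset.set0; rewrite // finset.setU0.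
move=> A B AB /imset2P[C D KC LD BE].
apply/imset2P; exists (A :&: C)%SET (A :&: D)%SET.
- by apply: Kd KC; rewrite finset.subsetIr.
- by apply: Ld LD; rewrite finset.subsetIr.
- by rewrite -finset.setIUr -BE; apply/esym/finset.setIidPl.
Qed.

Lemma union_complex K L :
  simplicial_complex K -> simplicial_complex L ->
  simplicial_complex (K :|: L)%SET.
Proof.
move=> [K0 Kd] [L0 Ld]; split; first by rewrite finset.in_setU K0.
move=> A B AB; rewrite !finset.in_setU => /orP[/(Kd _ _ AB)->//|/(Ld _ _ AB)->].
exact: orbT.
Qed.

End SimplicialComplexes.

Section Spaces.
Context (R : realType).

(* The canonical norm on 'rV[R]_n is the max norm, hence the explicit
   Euclidean formulas. *)
Definition disc (n : nat) : set 'rV[R]_n :=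
  [set x | \sum_i x ord0 i ^+ 2 <= 1].
Arguments disc : clear implicits.

Definition sphere (n : nat) : set 'rV[R]_n.+1 :=
  [set x | \sum_i x ord0 i ^+ 2 = 1].
Arguments sphere : clear implicits.

Lemma sphere_base_proof (n : nat) :
  (delta_mx ord0 ord0 : 'rV[R]_n.+1) \in sphere n.
Proof.
apply/mem_set; rewrite /sphere /= (bigD1 ord0) //= big1 => [|i i0].
  by rewrite mxE !eqxx expr1n addr0.
by rewrite mxE (negbTE i0) andbF expr0n.
Qed.

Definition sphere_base (n : nat) : sphere n := SigSub (sphere_base_proof n).

Definition moment_angle_set (m : nat) (K : {set {set 'I_m}}) :
    set (prod_topology (fun _ : 'I_m => 'rV[R]_2)) :=
  \bigcup_(I in [set` K])
    [set x | (forall j, disc 2 (x j)) /\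
             (forall j, j \notin I -> sphere 1 (x j))].

Definition moment_angle (m : nat) (K : {set {set 'I_m}}) : topologicalType :=
  set_type (moment_angle_set K).

(* Continuity within X x [0, 1] is continuity for the subspace topology, so
   the values of H at times outside [0, 1] are irrelevant. *)
Definition homotopic (X Y : topologicalType) (f g : X -> Y) : Prop :=
  exists H : X * R -> Y,
    [/\ {within [set: X] `*` `[0, 1], continuous H},
        forall x, H (x, 0) = f x
      & forall x, H (x, 1) = g x].

Definition homotopy_equivalent (X Y : topologicalType) : Prop :=
  exists (f : X -> Y) (g : Y -> X),
    [/\ continuous f, continuous g,
        homotopic (g \o f) idfun & homotopic (f \o g) idfun].

(* The index type is nonempty because the library's wedge over an empty index
   type is the empty space, not the one-point space. *)
Definition wedge_of_spheres (k : nat) (d : 'I_k.+1 -> nat) : topologicalType :=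
  wedge (fun i => sphere_base (d i)).

End Spaces.

Arguments disc : clear implicits.
Arguments sphere : clear implicits.
Arguments moment_angle_set R {m} K.
Arguments moment_angle R {m} K.

(* The vertices 1, ..., 6 are the ordinals 0, ..., 5. *)
Definition vertex (i : nat) : 'I_6 := inord i.-1.

Definition triangle (a b c : nat) : {set 'I_6} :=
  [set vertex a; vertex b; vertex c]%SET.

Definition complexK : {set {set 'I_6}} :=
  (join (simplex_boundary (triangle 1 2 3)) (simplex_boundary (triangle 4 5 6))
   :|: full_simplex (triangle 1 2 3) :|: full_simplex (triangle 4 5 6))%SET.

Lemma complexK_complex : simplicial_complex complexK.
Proof.
have T0 a b c : triangle a b c != finset.set0.
  by apply/set0Pn; exists (vertex a); rewrite !inE eqxx.
apply: union_complex; last exact: full_simplex_complex.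
apply: union_complex; last exact: full_simplex_complex.
by apply: join_complex; exact: simplex_boundary_complex.
Qed.

(* Main.v *)
(* Write D = (D^2)^3, S for its boundary and T in S for the 3-torus, so that
   Z_K = S x S u D x T u T x D inside D x D.  The wedge D x 1 u 1 x D is
   contractible, and S x S u D x 1 u 1 x D arises from it by attaching one
   10-cell.  The torus is then filled in one circle coordinate at a time: this
   attaches a product D^7 x T^j (j = 0, 1, 2), whose attaching map is
   null-homotopic since the new coordinate can first be contracted in S, after
   which the point of D can be moved to 1.

   Attaching D^n x T^j along a null-homotopic map amounts to attaching cells
   along null-homotopic maps: attach D^n x T^(j-1) x 1 first; on the boundary
   of the remaining D^(n+1) x T^(j-1) the attaching map deforms to one factoring
   through the projection to D^n x T^(j-1), and D^n contracts to a boundary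
   point.  A cell attached along a null-homotopic map to a space equivalent to
   a wedge of spheres gives a wedge with one more sphere. *)

Require Import Defs.
From mathcomp Require Import all_boot all_order all_algebra.
From mathcomp Require Import all_classical all_reals all_analysis.
From mathcomp Require Import wedge_sigT ring lra.
Set Implicit Arguments.
Unset Strict Implicit.
Unset Printing Implicit Defensive.

Import Order.TTheory GRing.Theory Num.Theory.
Import numFieldNormedType.Exports.

Local Open Scope classical_set_scope.
Local Open Scope ring_scope.

(** * Continuity on a subset *)

(** No adjunction space is ever formed. Every stage is a subset of a fixed ambient Hausdorff space,
    and a cell is a map of a cube that is injective on the interior and sends the boundary into a
    compact subset; compactness together with the Hausdorff property does the work of the quotient
    topology. The stages of [Z_K] and the partial wedges of spheres thus fall under one notion, and
    the equivalences between them are given by formulas on cells.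

    The circle coordinates are freed one at a time for the sake of the null-homotopy. Over an
    interior point of D the torus point is confined to the part of T that is already filled, while
    over a point of S it may move anywhere in S. With a single new coordinate the two cases agree:
    on the boundary either that coordinate is 1 already, or the point of D is in S and the
    coordinate may leave its circle, the point of the other factor staying in S because its
    remaining coordinates are still on their circles. *)

Definition cont_on (T U : topologicalType) (A : set T) (f : T -> U) : Prop :=
  forall x, A x ->
    forall W, nbhs (f x) W -> \forall y \near x, A y -> W (f y).

Section ContOn.
Context {T U : topologicalType}.
Implicit Types (A : set T) (B : set U).

Lemma cvg_cont_on A (f : T -> U) :
  (forall x, A x -> f @ within A (nbhs x) --> f x) -> cont_on A f.
Proof. by move=> cf x Ax; exact: cf. Qed.

Lemma cont_onP A (f : T -> U) : {within A, continuous f} <-> cont_on A f.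
Proof.
split => [/subspace_continuousP|cf]; first exact: cvg_cont_on.
by apply/subspace_continuousP => x Ax; exact: cf.
Qed.

Lemma continuous_cont_on A (f : T -> U) : continuous f -> cont_on A f.
Proof.
move=> cf x Ax W nW; have h : \forall y \near x, W (f y) := cf x _ nW.
by apply: filterS h.
Qed.

End ContOn.

Section ContOnComp.
Context {T U V : topologicalType}.
Implicit Types (A : set T) (B : set U).

Lemma cont_on_sub A A' (f : T -> U) : A' `<=` A -> cont_on A f -> cont_on A' f.
Proof.
by move=> s cf x /s Ax W /(cf x Ax); apply: filterS => y h /s.
Qed.

Lemma cont_on_eq A (f g : T -> U) :
  (forall x, A x -> f x = g x) -> cont_on A f -> cont_on A g.
Proof.
move=> fg cf x Ax W; rewrite -fg // => /(cf x Ax).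
by apply: filterS => y h Ay; rewrite -fg //; exact: h.
Qed.

Lemma cont_on_comp A B (f : T -> U) (g : U -> V) :
  cont_on B g -> cont_on A f -> (forall x, A x -> B (f x)) ->
  cont_on A (g \o f).
Proof.
move=> cg cf fAB x Ax W /(cg _ (fAB _ Ax)) /(cf x Ax).
by apply: filterS => y h Ay; apply: h => //; exact: fAB.
Qed.

Lemma cont_on_pair A (f : T -> U) (g : T -> V) :
  cont_on A f -> cont_on A g -> cont_on A (fun x => (f x, g x)).
Proof.
move=> cf cg; apply: cvg_cont_on => x Ax.
by apply: cvg_pair; [exact: cf|exact: cg].
Qed.

Lemma cont_on_id A : cont_on A id.
Proof. by apply: continuous_cont_on => x. Qed.

Lemma cont_on_cst A (c : U) : cont_on A (fun=> c).
Proof. by apply: continuous_cont_on => x; exact: cvg_cst. Qed.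

End ContOnComp.

Lemma cont_on_fst (T U : topologicalType) (A : set (T * U)) : cont_on A fst.
Proof. by apply: continuous_cont_on => x; exact: cvg_fst. Qed.

Lemma cont_on_snd (T U : topologicalType) (A : set (T * U)) : cont_on A snd.
Proof. by apply: continuous_cont_on => x; exact: cvg_snd. Qed.

Lemma cont_on_compc (T U V : topologicalType) (A : set T) (f : T -> U)
  (g : U -> V) : continuous g -> cont_on A f -> cont_on A (g \o f).
Proof.
by move=> cg cf; apply: (@cont_on_comp _ _ _ A setT) => //;
  exact: continuous_cont_on.
Qed.

Section ContOnReal.
Context {R : realType} {T : topologicalType}.
Implicit Types (A : set T) (f g : T -> R).

Lemma cont_onD (W : pseudoMetricNormedZmodType R) A (f g : T -> W) :
  cont_on A f -> cont_on A g -> cont_on A (fun x => f x + g x).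
Proof.
move=> cf cg; apply: cvg_cont_on => x Ax.
by apply: cvgD; [exact: cf|exact: cg].
Qed.

Lemma cont_onN (W : pseudoMetricNormedZmodType R) A (f : T -> W) :
  cont_on A f -> cont_on A (fun x => - f x).
Proof.
move=> cf; apply: cvg_cont_on => x Ax.
by apply: cvgN; exact: cf.
Qed.

Lemma cont_onM A f g :
  cont_on A f -> cont_on A g -> cont_on A (fun x => f x * g x).
Proof.
move=> cf cg; apply: cvg_cont_on => x Ax.
by apply: cvgM; [exact: cf|exact: cg].
Qed.

Lemma cont_onX A f n : cont_on A f -> cont_on A (fun x => f x ^+ n).
Proof.
move=> cf; elim: n => [|n IH]; first exact: cont_on_cst.
by apply: cont_on_eq (cont_onM cf IH) => x _; rewrite exprS.
Qed.

Lemma cont_onV A f : (forall x, A x -> f x != 0) ->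
  cont_on A f -> cont_on A (fun x => (f x)^-1).
Proof.
move=> f0 cf; apply: cvg_cont_on => x Ax.
by apply: cvgV; [exact: f0|exact: cf].
Qed.

Lemma cont_on_sum (I : finType) (P : pred I) A (F : I -> T -> R) :
  (forall i, cont_on A (F i)) -> cont_on A (fun x => \sum_(i | P i) F i x).
Proof.
move=> cF; elim: (index_enum I) => [|i s IH].
  apply: (@cont_on_eq _ _ _ (fun=> 0)); last exact: cont_on_cst.
  by move=> x _; rewrite big_nil.
apply: (@cont_on_eq _ _ _ (fun x => (if P i then F i x else 0) +
    \sum_(j <- s | P j) F j x)).
  by move=> x _; rewrite big_cons; case: ifP; rewrite ?add0r.
by apply: cont_onD => //; case: (P i) => //; exact: cont_on_cst.
Qed.

Lemma cont_on_sqrt A f : cont_on A f -> cont_on A (fun x => Num.sqrt (f x)).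
Proof. by apply: cont_on_compc; exact: sqrt_continuous. Qed.

Lemma cont_on_max A f g :
  cont_on A f -> cont_on A g -> cont_on A (fun x => Num.max (f x) (g x)).
Proof.
move=> cf cg.
apply: (@cont_on_eq _ _ _ (fun x => (f x + g x + `|f x - g x|) / 2%:R)).
  by move=> x _; rewrite maxr_absE.
apply: cont_onM; last exact: cont_on_cst.
apply: cont_onD; first exact: cont_onD.
apply: (@cont_on_compc _ _ _ A (fun x => f x - g x)); first exact: norm_continuous.
by apply: cont_onD => //; exact: cont_onN.
Qed.

Lemma cont_on_min A f g :
  cont_on A f -> cont_on A g -> cont_on A (fun x => Num.min (f x) (g x)).
Proof.
move=> cf cg; apply: (@cont_on_eq _ _ _ (fun x => - Num.max (- f x) (- g x))).
  by move=> x _; rewrite oppr_max !opprK.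
by apply: cont_onN; apply: cont_on_max; exact: cont_onN.
Qed.

Lemma cont_on_norm (W : normedModType R) A (f : T -> W) :
  cont_on A f -> cont_on A (fun x => `|f x|).
Proof. by apply: cont_on_compc; exact: norm_continuous. Qed.

Lemma cont_on_scale (W : normedModType R) A (f : T -> R) (g : T -> W) :
  cont_on A f -> cont_on A g -> cont_on A (fun x => f x *: g x).
Proof.
move=> cf cg; apply: cvg_cont_on => x Ax.
by apply: cvgZ; [exact: cf|exact: cg].
Qed.

Lemma cont_on_coord n A (f : T -> 'rV[R]_n) (i : 'I_n) :
  cont_on A f -> cont_on A (fun x => f x ord0 i).
Proof.
exact: (@cont_on_compc _ _ _ A f (fun v : 'rV[R]_n => v ord0 i)
  (@coord_continuous _ _ _ _ _)).
Qed.

Lemma cont_on_row n A (f : T -> 'rV[R]_n) :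
  (forall i, cont_on A (fun x => f x ord0 i)) -> cont_on A f.
Proof.
move=> cf x Ax W [E nE EW].
have : \forall y \near x, forall i, A y -> E ord0 i (f y ord0 i).
  by apply: filter_forall => i; exact: (cf i x Ax _ (nE ord0 i)).
by apply: filterS => y Ey Ay; apply: EW => i j; rewrite ord1; exact: Ey.
Qed.

(** A closed piece that misses [x] also misses the nearby points of [A], so only the pieces that
    contain [x] constrain the value near [x]. *)
Lemma cont_on_paste (U : topologicalType) A (r : T -> R) (a : R)
    (f g : T -> U) :
  cont_on A r ->
  cont_on (A `&` [set x | r x <= a]) f -> cont_on (A `&` [set x | a <= r x]) g ->
  (forall x, A x -> r x = a -> f x = g x) ->
  cont_on A (fun x => if r x <= a then f x else g x).
Proof.
move=> cr cf cg fg x Ax W nW.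
have h1 : \forall y \near x, A y -> r y <= a -> W (f y).
  have [rxa|rxa] := leP (r x) a.
    rewrite rxa in nW; have := cf x (conj Ax rxa) _ nW.
    by apply: filterS => y h Ay ya; apply: h.
  have := cr x Ax [set t | a < t] (lt_nbhsr rxa).
  by apply: filterS => y + Ay => /(_ Ay) /= ay; rewrite leNgt ay.
have h2 : \forall y \near x, A y -> a <= r y -> W (g y).
  have [rxa|rxa] := leP a (r x).
    have nW' : nbhs (g x) W.
      by move: nW; case: ifP => // xa; rewrite fg //; apply/le_anti; rewrite xa.
    have := cg x (conj Ax rxa) _ nW'.
    by apply: filterS => y h Ay ya; apply: h.
  have := cr x Ax [set t | t < a] (lt_nbhsl rxa).
  by apply: filterS => y + Ay => /(_ Ay) /= ay; rewrite leNgt ay.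
apply: filterS (filterI h1 h2) => y [w1 w2] Ay /=.
by case: ifPn => [/w1|]; [exact|rewrite -ltNge => /ltW /w2; exact].
Qed.

End ContOnReal.

(** * Homotopies and homotopy equivalences of subsets *)

Definition clamp (R : realType) (t : R) : R := Num.max 0 (Num.min 1 t).

Section Clamp.
Context {R : realType}.
Implicit Types t : R.

Lemma clamp_ge0 t : 0 <= clamp t.
Proof. by rewrite /clamp le_max lexx. Qed.

Lemma clamp_le1 t : clamp t <= 1.
Proof. by rewrite /clamp ge_max ler01 ge_min lexx. Qed.

Lemma clamp0 t : t <= 0 -> clamp t = 0.
Proof.
by move=> t0; rewrite /clamp max_l // ge_min t0 orbT.
Qed.

Lemma clamp1 t : 1 <= t -> clamp t = 1.
Proof. by move=> t1; rewrite /clamp (min_l t1) max_r. Qed.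

Lemma cont_on_clamp (T : topologicalType) (A : set T) (f : T -> R) :
  cont_on A f -> cont_on A (fun x => clamp (f x)).
Proof. move=> cf; rewrite /clamp; apply: cont_on_max; first exact: cont_on_cst.
by apply: cont_on_min => //; exact: cont_on_cst. Qed.

End Clamp.

Section Projections.
Context {T U V : topologicalType} (A : set T) (f : T -> U * V).

Lemma cont_on_proj1 : cont_on A f -> cont_on A (fun x => (f x).1).
Proof. by apply: cont_on_compc => x; exact: cvg_fst. Qed.

Lemma cont_on_proj2 : cont_on A f -> cont_on A (fun x => (f x).2).
Proof. by apply: cont_on_compc => x; exact: cvg_snd. Qed.

End Projections.

(** Inverses are left to the caller, since their continuity needs a nonvanishing condition. The last
    clause eta-expands a bare function so that the patterns apply, and the clause before it stops
    the search on any other abstraction. *)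
Ltac cont_step := first
  [ assumption
  | match goal with
    | |- cont_on _ (fun _ => ?c) => exact: cont_on_cst
    | |- cont_on _ (fun x => x) => exact: cont_on_id
    | |- cont_on _ id => exact: cont_on_id
    | |- cont_on _ fst => exact: cont_on_fst
    | |- cont_on _ snd => exact: cont_on_snd
    | |- cont_on _ (fun _ => (_, _)) => apply: cont_on_pair
    | |- cont_on _ (fun _ => _ + _) => apply: cont_onD
    | |- cont_on _ (fun _ => - _) => apply: cont_onN
    | |- cont_on _ (fun _ => _ * _) => apply: cont_onM
    | |- cont_on _ (fun _ => _ ^+ _) => apply: cont_onX
    | |- cont_on _ (fun _ => _ *: _) => apply: cont_on_scale
    | |- cont_on _ (fun _ => Num.max _ _) => apply: cont_on_max
    | |- cont_on _ (fun _ => Num.min _ _) => apply: cont_on_min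
    | |- cont_on _ (fun _ => `| _ |) => apply: cont_on_norm
    | |- cont_on _ (fun _ => Num.sqrt _) => apply: cont_on_sqrt
    | |- cont_on _ (fun _ => \sum_(_ | _) _) => apply: cont_on_sum => ?
    | |- cont_on _ (fun _ => fun_of_matrix _ ord0 _) => apply: cont_on_coord
    | |- cont_on _ (fun _ => clamp _) => apply: cont_on_clamp
    | |- cont_on _ (fun _ => fst _) => apply: cont_on_proj1
    | |- cont_on _ (fun _ => snd _) => apply: cont_on_proj2
    | |- cont_on _ (fun _ => _) => fail 1
    | |- cont_on ?A ?f => change (cont_on A (fun x => f x))
    end ].

Ltac cont := repeat cont_step.

Section Homotopy.
Context (R : realType).

Definition maps (T U : topologicalType) (A : set T) (B : set U) (f : T -> U) :=
  cont_on A f /\ forall x, A x -> B (f x).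

(** Time ranges over all of [R], so that reversal and concatenation are plain reparametrisations
    without range conditions; formulas that make sense only on [0, 1] are fed with [clamp]. *)
Definition is_htp (T U : topologicalType) (A : set T) (B : set U)
    (H : T * R -> U) (f g : T -> U) : Prop :=
  [/\ cont_on (A `*` setT) H, forall x t, A x -> B (H (x, t)),
      forall x, A x -> H (x, 0) = f x & forall x, A x -> H (x, 1) = g x].

Definition htp (T U : topologicalType) (A : set T) (B : set U) (f g : T -> U) :=
  exists H : T * R -> U, is_htp A B H f g.

Definition heq (T U : topologicalType) (A : set T) (B : set U) :=
  exists (f : T -> U) (g : U -> T),
    [/\ maps A B f, maps B A g, htp A A (g \o f) id & htp B B (f \o g) id].

Section Basics.
Context {T U V : topologicalType} {A : set T} {B : set U} {C : set V}.

Lemma maps_comp (f : T -> U) (g : U -> V) :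
  maps A B f -> maps B C g -> maps A C (g \o f).
Proof.
move=> [cf fAB] [cg gBC]; split; first exact: cont_on_comp cg cf fAB.
by move=> x /fAB /gBC.
Qed.

Lemma htp_eq (f g : T -> U) : maps A B f -> (forall x, A x -> f x = g x) ->
  htp A B f g.
Proof.
move=> [cf fAB] fg; exists (fun p => f p.1); split => //=.
- by apply: (cont_on_comp cf); [cont|move=> ? []].
- by move=> x _; exact: fAB.
Qed.

Lemma htp_sym (f g : T -> U) : htp A B f g -> htp A B g f.
Proof.
move=> [H [cH HB H0 H1]]; exists (fun p => H (p.1, 1 - p.2)); split => /=.
- by apply: (cont_on_comp cH); [cont|move=> ? []].
- by move=> x t /HB.
- by move=> x Ax; rewrite subr0 H1.
- by move=> x Ax; rewrite subrr H0.
Qed.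

Lemma htp_trans (g f h : T -> U) : htp A B f g -> htp A B g h -> htp A B f h.
Proof.
move=> [H [cH HB H0 H1]] [K [cK KB K0 K1]].
exists (fun p => if p.2 <= 2^-1 then H (p.1, 2 * p.2) else K (p.1, 2 * p.2 - 1)).
split => /=.
- apply: cont_on_paste.
  + by cont.
  + by apply: (cont_on_comp cH); [cont|move=> ? [[]]].
  + by apply: (cont_on_comp cK); [cont|move=> ? [[]]].
  + move=> [x t] /= [Ax _] ->; rewrite mulfV // subrr H1 // K0 //.
- by move=> x t Ax; case: ifP => _; [exact: HB|exact: KB].
- by move=> x Ax; rewrite mulr0 ifT ?H0 // invr_ge0.
- move=> x Ax; rewrite ifF; last by apply/negbTE; rewrite -ltNge; lra.
  by rewrite mulr1 (_ : 2 - 1 = 1 :> R) ?K1 //; lra.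
Qed.

Lemma htp_post (f g : T -> U) (h : U -> V) :
  htp A B f g -> maps B C h -> htp A C (h \o f) (h \o g).
Proof.
move=> [H [cH HB H0 H1]] [ch hBC]; exists (h \o H); split => /=.
- by apply: (cont_on_comp ch cH) => -[x t] [Ax _]; exact: HB.
- by move=> x t Ax; apply/hBC/HB.
- by move=> x Ax; rewrite H0.
- by move=> x Ax; rewrite H1.
Qed.

Lemma htp_pre (f g : U -> V) (h : T -> U) :
  htp B C f g -> maps A B h -> htp A C (f \o h) (g \o h).
Proof.
move=> [H [cH HB H0 H1]] [ch hAB]; exists (fun p => H (h p.1, p.2)); split => /=.
- apply: (cont_on_comp cH).
    by apply: cont_on_pair; [apply: (cont_on_comp ch); [cont|move=> ? []]|cont].
  by move=> [x t] [Ax _]; split => //; exact: hAB.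
- by move=> x t /hAB/HB.
- by move=> x /hAB/H0.
- by move=> x /hAB/H1.
Qed.

End Basics.

Lemma maps_id (T : topologicalType) (A : set T) : maps A A id.
Proof. by split => //; exact: cont_on_id. Qed.

Lemma heq_sym (T U : topologicalType) (A : set T) (B : set U) :
  heq A B -> heq B A.
Proof. by move=> [f [g []]]; exists g, f; split. Qed.

Lemma heq_trans (T U V : topologicalType) (B : set U) (A : set T) (C : set V) :
  heq A B -> heq B C -> heq A C.
Proof.
have aux (T' U' V' : topologicalType) (B' : set U') (A' : set T') (C' : set V')
    (f : T' -> U') (g : U' -> T') (f' : U' -> V') (g' : V' -> U') :
    maps A' B' f -> maps B' A' g -> htp B' B' (g' \o f') id ->
    htp A' A' (g \o f) id -> htp A' A' ((g \o g') \o (f' \o f)) id.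
  move=> mf mg hB hA; apply: htp_trans hA.
  by have := htp_post (htp_pre hB mf) mg.
move=> [f [g [mf mg hA hB]]] [f' [g' [mf' mg' hB' hC]]].
exists (f' \o f), (g \o g'); split.
- exact: maps_comp mf mf'.
- exact: maps_comp mg' mg.
- exact: aux mf mg hB' hA.
- exact: aux mg' mf' hB hC.
Qed.

End Homotopy.

(** * Attaching a cell *)

Definition cube {R : realType} n : set 'rV[R]_n := [set x | `|x| <= 1].
Arguments cube {R} n _ /.

Section Cube.
Context {R : realType}.
Implicit Types n : nat.


Lemma compact_cube n : compact (@cube R n).
Proof.
apply: bounded_closed_compact.
  exists 1; split; first exact: num_real.
  by move=> M M1 x /= x1; exact: le_trans x1 (ltW M1).
have -> : @cube R n = (fun x : 'rV[R]_n => `|x|) @^-1` [set t | t <= 1] by [].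
by apply: preimage_closed => [x _|]; [exact: norm_continuous|exact: closed_le].
Qed.

End Cube.

Section Attach.
Context {R : realType}.

(** In a Hausdorff space these conditions say that [Phi] is a relative homeomorphism from the cube
    and its boundary to [X] and [Y]; compactness of [Y] makes [Y] closed. *)
Record attach (T : topologicalType) n (Y X : set T) (Phi : 'rV[R]_n -> T) :
    Prop := Attach {
  attach_compact : compact Y;
  attach_cont : cont_on (cube n) Phi;
  attach_bd : forall x, `|x| = 1 -> Y (Phi x);
  attach_inj : forall x y, `|x| < 1 -> `|y| < 1 -> Phi x = Phi y -> x = y;
  attach_out : forall x, `|x| < 1 -> ~ Y (Phi x);
  attach_eq : X = Y `|` Phi @` cube n }.

(** The time parameter lets one statement serve both maps ([glue_map]) and homotopies
    ([glue_htp]). *)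
Lemma glue (T V : topologicalType) n (Y X : set T) (Phi : 'rV[R]_n -> T)
    (f : T * R -> V) (phi : 'rV[R]_n * R -> V) :
  hausdorff_space T -> attach Y X Phi ->
  cont_on (Y `*` setT) f -> cont_on (cube n `*` setT) phi ->
  (forall x t, `|x| = 1 -> f (Phi x, t) = phi (x, t)) ->
  exists F : T * R -> V,
    [/\ cont_on (X `*` setT) F, forall y t, Y y -> F (y, t) = f (y, t) &
        forall x t, cube n x -> F (Phi x, t) = phi (x, t)].
Proof.
move=> hT [cY cPhi bdPhi injPhi outPhi ->] cf cphi fphi.
(* Outside [Y] this choice is forced: a preimage on the boundary would lie over [Y], and interior
   preimages are unique. *)
pose c z : 'rV[R]_n := xget 0 [set x | cube n x /\ Phi x = z].
pose F p := if `[< Y p.1 >] then f p else phi (c p.1, p.2).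
have FY y t : Y y -> F (y, t) = f (y, t) by move=> Yy; rewrite /F asboolT.
have FPhi x t : cube n x -> F (Phi x, t) = phi (x, t).
  rewrite /cube /= le_eqVlt => /predU1P[x1|x1].
    by rewrite FY; [exact: fphi|exact: bdPhi].
  rewrite /F asboolF /=; last exact: outPhi.
  suff -> : c (Phi x) = x by [].
  have [] : [set y | cube n y /\ Phi y = Phi x] (c (Phi x)).
    by apply: xgetPex; exists x; split => //; exact: ltW.
  rewrite /cube /= le_eqVlt => /predU1P[c1 E|c1]; last exact: injPhi.
  by case: (outPhi _ x1); rewrite -E; exact: bdPhi.
exists F; split => // -[z0 t0] [/= Xz0 _] W nW.
have nearY : \forall p \near (z0, t0), Y p.1 -> W (F p).
  have [Yz0|nYz0] := pselect (Y z0).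
    rewrite FY // in nW; apply: filterS (cf (z0, t0) (conj Yz0 I) _ nW).
    by move=> [z t] h /= Yz; rewrite FY //; exact: h.
  have oY : open (~` Y) by apply: closed_openC; exact: compact_closed.
  have nY : nbhs z0 (~` Y) by exact: open_nbhs_nbhs.
  exists (~` Y, setT); first by split => //=; exact: filterT.
  by move=> [z t] [/= nYz _] /nYz.
have nearPhi : \forall p \near (z0, t0), forall x, cube n x -> Phi x = p.1 ->
    W (F p).
  (* Tube argument: by compactness of the cube it is enough to work near each [x] in it. If [Phi x]
     is [z0], continuity of [phi] applies; otherwise the Hausdorff property separates [Phi x] from
     [z0], and no nearby pair satisfies the equation. *)
  have /compact_near_coveringP/near_covering_withinP nc := @compact_cube R n.
  apply: (nc _ (nbhs (z0, t0)) (fun p x => Phi x = p.1 -> W (F p))).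
  move=> x x1.
  have [E|NE] := pselect (Phi x = z0).
    rewrite -E FPhi // in nW.
    have [[A B] /= [nA nB] AB] := cphi (x, t0) (conj x1 I) _ nW.
    exists (A, [set p | B p.2]); first by split => //=; exact: cvg_snd.
    move=> [x' [z t]] /= [Ax Bt] x'1 <-; rewrite FPhi //.
    by apply: (AB (x', t)).
  move: hT; rewrite open_hausdorff => /(_ _ _ (introN eqP NE)) [[A B] /= [Ax Bz]].
  move=> [oA oB AB0]; rewrite !inE in Ax Bz.
  exists ([set x' | cube n x' -> A (Phi x')], [set p | B p.1]).
    split => /=; first by apply: cPhi => //; exact: open_nbhs_nbhs.
    exists (B, setT); last by move=> [? ?] [].
    by split => /=; [exact: open_nbhs_nbhs|exact: filterT].
  move=> [x' [z t]] /= [Ax' Bz'] x'1 E; exfalso.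
  suff : set0 z by [].
  by rewrite -(eqP AB0); split => //; rewrite -E; exact: Ax'.
apply: filterS (filterI nearY nearPhi) => -[z t] [hY hPhi] [/= [Yz|[x x1 E]] _].
  exact: hY.
exact: hPhi E.
Qed.

Lemma glue_map (T V : topologicalType) n (Y X : set T) (B : set V)
    (Phi : 'rV[R]_n -> T) (f : T -> V) (phi : 'rV[R]_n -> V) :
  hausdorff_space T -> attach Y X Phi ->
  maps Y B f -> maps (cube n) B phi ->
  (forall x, `|x| = 1 -> f (Phi x) = phi x) ->
  exists F : T -> V,
    [/\ maps X B F, forall y, Y y -> F y = f y &
        forall x, cube n x -> F (Phi x) = phi x].
Proof.
move=> hT aT [cf fB] [cphi phiB] fphi.
have [|||F [cF FY FPhi]] := @glue _ _ _ _ _ _ (f \o fst) (phi \o fst) hT aT.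
- by apply: cont_on_comp cf _ _; [cont|move=> ? []].
- by apply: cont_on_comp cphi _ _; [cont|move=> ? []].
- by move=> x t /fphi.
exists (fun x => F (x, 0)); split.
- split; first by apply: cont_on_comp cF _ _ => //; cont.
  move=> x; rewrite (attach_eq aT) => -[Yx|[y y1 <-]].
    by rewrite FY //; exact: fB.
  by rewrite FPhi //; exact: phiB.
- by move=> y Yy; rewrite FY.
- by move=> x x1; rewrite FPhi.
Qed.

Lemma glue_htp (T V : topologicalType) n (Y X : set T) (B : set V)
    (Phi : 'rV[R]_n -> T) (f g : T -> V) (h : T * R -> V)
    (phi : 'rV[R]_n * R -> V) :
  hausdorff_space T -> attach Y X Phi ->
  cont_on (Y `*` setT) h -> (forall y t, Y y -> B (h (y, t))) ->
  cont_on (cube n `*` setT) phi -> (forall x t, cube n x -> B (phi (x, t))) ->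
  (forall x t, `|x| = 1 -> h (Phi x, t) = phi (x, t)) ->
  (forall y, Y y -> h (y, 0) = f y) -> (forall y, Y y -> h (y, 1) = g y) ->
  (forall x, cube n x -> phi (x, 0) = f (Phi x)) ->
  (forall x, cube n x -> phi (x, 1) = g (Phi x)) ->
  htp R X B f g.
Proof.
move=> hT aT ch hB cphi phiB hphi h0 h1 phi0 phi1.
have [F [cF FY FPhi]] := glue hT aT ch cphi hphi.
exists F; split => //.
- move=> x t; rewrite (attach_eq aT) => -[Yx|[y y1 <-]].
    by rewrite FY //; exact: hB.
  by rewrite FPhi //; exact: phiB.
- move=> x; rewrite (attach_eq aT) => -[Yx|[y y1 <-]].
    by rewrite FY // h0.
  by rewrite FPhi // phi0.
- move=> x; rewrite (attach_eq aT) => -[Yx|[y y1 <-]].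
    by rewrite FY // h1.
  by rewrite FPhi // phi1.
Qed.

End Attach.

(** * Extending a homotopy equivalence over an attached cell *)

Section Rho.
Context {R : realType} {n : nat}.
Implicit Types x : 'rV[R]_n.

Definition bdcube : set 'rV[R]_n := [set x | `|x| = 1].

Definition dir x := `|x|^-1 *: x.

(** The radial retraction of the whole space onto the cube. *)
Definition rho x := (Num.max 1 `|x|)^-1 *: x.

Lemma rho_norm x : `|rho x| <= 1.
Proof.
have m0 : 0 < Num.max 1 `|x| by rewrite lt_max ltr01.
by rewrite /rho normrZ normfV gtr0_norm // ler_pdivrMl // mulr1 le_max lexx orbT.
Qed.

Lemma rho_id x : `|x| <= 1 -> rho x = x.
Proof. by move=> x1; rewrite /rho max_l // invr1 scale1r. Qed.

Lemma rho_dir x : 1 <= `|x| -> rho x = dir x.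
Proof. by move=> x1; rewrite /rho max_r. Qed.

Lemma norm_dir x : 0 < `|x| -> `|dir x| = 1.
Proof. by move=> x0; rewrite /dir normrZ normfV normr_id mulVf // gt_eqF. Qed.

Lemma dir_id x : `|x| = 1 -> dir x = x.
Proof. by move=> x1; rewrite /dir x1 invr1 scale1r. Qed.

Lemma dirZ (a : R) x : 0 < a -> dir (a *: x) = dir x.
Proof.
move=> a0; rewrite /dir normrZ gtr0_norm // scalerA; congr (_ *: _).
by rewrite invfM mulrC mulrA mulfV ?mul1r // gt_eqF.
Qed.

Lemma cont_on_rho (T : topologicalType) (A : set T) (f : T -> 'rV[R]_n) :
  cont_on A f -> cont_on A (fun y => rho (f y)).
Proof.
move=> cf; apply: cont_on_scale => //; apply: cont_onV; last by cont.
by move=> y _; rewrite gt_eqF // lt_max ltr01.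
Qed.

Lemma cont_on_dir (T : topologicalType) (A : set T) (f : T -> 'rV[R]_n) :
  (forall y, A y -> 0 < `|f y|) ->
  cont_on A f -> cont_on A (fun y => dir (f y)).
Proof.
move=> f0 cf; apply: cont_on_scale => //; apply: cont_onV; last by cont.
by move=> y /f0 h; rewrite gt_eqF.
Qed.

End Rho.
Arguments bdcube {R} n _ /.

Section Extension.
Context {R : realType} {T T' : topologicalType} {n : nat}.
Context {Y X : set T} {Phi : 'rV[R]_n -> T}.
Context {Y' X' : set T'} {Phi' : 'rV[R]_n -> T'}.
Hypotheses (hT : hausdorff_space T) (hT' : hausdorff_space T').
Hypotheses (aX : attach Y X Phi) (aX' : attach Y' X' Phi').

(* On the outer half of the cell F runs through the homotopy h, on the inner
   half through the whole cell of X'. *)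
Definition extends (f : T -> T') (h : 'rV[R]_n * R -> T') (F : T -> T') :=
  [/\ maps X X' F, forall y, Y y -> F y = f y,
      forall x, `|x| <= 2^-1 -> F (Phi x) = Phi' (2 *: x) &
      forall x, 2^-1 <= `|x| <= 1 -> F (Phi x) = h (dir x, 2 - 2 * `|x|)].

(** The time [2 - 2 * |x|] is 0 on the boundary of the cell, where [h] agrees with [f], and 1 at
    radius 1/2, where [h] agrees with the stretched cell; so all pieces match. *)
Lemma extends_ex f h :
  maps Y Y' f -> is_htp (bdcube n) Y' h (f \o Phi) Phi' ->
  exists F, extends f h F.
Proof.
move=> mf [ch hY h0 h1].
pose phi x := if `|x| <= 2^-1 then Phi' (2 *: x) else h (dir x, 2 - 2 * `|x|).
have half1 : (2^-1 : R) < 1 by lra.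
have half0 : (0 : R) < 2^-1 by lra.
have norm2 x : `|x| <= 2^-1 -> `|2 *: x : 'rV[R]_n| <= 1.
  by move=> x2; rewrite normrZ ger0_norm //; lra.
have agree x : `|x| = 2^-1 -> Phi' (2 *: x) = h (dir x, 2 - 2 * `|x|).
  move=> x2; rewrite /dir x2 invrK (_ : 2 - _ = 1); last by lra.
  by rewrite h1 //= normrZ x2 ger0_norm // mulfV.
have XY' : Y' `<=` X' by rewrite (attach_eq aX') => y; left.
have phi_bd x : `|x| = 1 -> f (Phi x) = phi x.
  move=> x1; rewrite /phi x1 ifF; last by apply/negbTE; rewrite -ltNge.
  by rewrite mulr1 subrr dir_id // h0.
have mphi : maps (cube n) X' phi.
  split.
    apply: cont_on_paste; first by cont.
    - apply: (cont_on_comp (attach_cont aX')); first by cont.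
      by move=> x [_]; exact: norm2.
    - apply: (cont_on_comp ch).
        apply: cont_on_pair; last by cont.
        apply: cont_on_dir; last by cont.
        by move=> x [_ /= x2]; exact: lt_le_trans x2.
      move=> x [_ /= x2]; split => //=; apply: norm_dir.
      exact: lt_le_trans x2.
    - by move=> x _; exact: agree.
  move=> x x1; rewrite /phi; case: ifPn => [x2|].
    by rewrite (attach_eq aX'); right; exists (2 *: x) => //; exact: norm2.
  rewrite -ltNge => x2; apply: XY'; apply: hY; apply: norm_dir.
  exact: lt_trans x2.
have mf' : maps Y X' f by case: mf => cf fY; split => // y /fY/XY'.
have [F [mF FY FPhi]] := glue_map hT aX mf' mphi phi_bd.
exists F; split => //.
  move=> x x2; rewrite FPhi /=; last by lra.
  by rewrite /phi x2.
move=> x /andP[x2 x1]; rewrite FPhi // /phi; case: ifP => // x2'.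
by apply: agree; apply/le_anti; rewrite x2 x2'.
Qed.

End Extension.

Section ExtensionInverse.
Context {R : realType} {T T' : topologicalType} {n : nat}.
Context {Y X : set T} {Phi : 'rV[R]_n -> T}.
Context {Y' X' : set T'} {Phi' : 'rV[R]_n -> T'}.
Hypotheses (hT : hausdorff_space T) (hT' : hausdorff_space T').
Hypotheses (aX : attach Y X Phi) (aX' : attach Y' X' Phi').

Lemma extends_linv (f : T -> T') (g : T' -> T) h F :
  maps Y Y' f -> maps Y' Y g -> htp R Y Y (g \o f) id ->
  is_htp (bdcube n) Y' h (f \o Phi) Phi' ->
  extends (Y := Y) (X := X) (Phi := Phi) (X' := X') (Phi' := Phi') f h F ->
  exists h' G,
    [/\ is_htp (bdcube n) Y h' (g \o Phi') Phi,
        extends (Y := Y') (X := X') (Phi := Phi') (X' := X) (Phi' := Phi) g h' G &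
        htp R X X (G \o F) id].
Proof.
move=> mf mg [k [ck kY k0 k1]] hh [mF FY Fin Fout].
have [ch hY h0 h1] := hh.
have bdY := attach_bd aX; have bdY' := attach_bd aX'.
have XY : Y `<=` X by rewrite (attach_eq aX) => y; left.
(* One path over the boundary: times -1 to 0 run the image of [h] under [g] backwards, from
   [g \o Phi'] to [g \o f \o Phi]; times 0 to 1 run [k] on to [Phi]. *)
pose Th p := if p.2 <= 0 then g (h (p.1, - p.2)) else k (Phi p.1, p.2).
have Th_ge a s : `|a| = 1 -> 0 <= s -> Th (a, s) = k (Phi a, s).
  move=> a1 s0; rewrite /Th /=; case: ifP => // s0'.
  have -> : s = 0 by apply/le_anti; rewrite s0 s0'.
  by rewrite oppr0 h0 //= k0 //; exact: bdY.
have cTh : cont_on (bdcube n `*` setT) Th.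
  apply: cont_on_paste; first by cont.
  - apply: (cont_on_comp (proj1 mg)).
      by apply: (cont_on_comp ch); [cont|move=> ? [[]]].
    by move=> p [[/= p1 _] _]; exact: hY.
  - apply: (cont_on_comp ck).
      apply: cont_on_pair; last by cont.
      apply: (cont_on_comp (attach_cont aX)); first by cont.
      by move=> p [[/= -> _] _].
    by move=> p [[/= p1 _] _]; split => //=; exact: bdY.
  - by move=> [a s] [/= a1 _] -> ; rewrite oppr0 h0 // k0 //; exact: bdY.
have ThY a s : `|a| = 1 -> Y (Th (a, s)).
  move=> a1; rewrite /Th /=; case: ifP => _; last by apply: kY; exact: bdY.
  by apply: (proj2 mg); exact: hY.
pose h' p := Th (p.1, 2 * p.2 - 1).
have hh' : is_htp (bdcube n) Y h' (g \o Phi') Phi.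
  split.
  - by apply: (cont_on_comp cTh); [cont|move=> ? []].
  - by move=> x t x1; exact: ThY.
  - move=> x x1; rewrite /h' /= mulr0 sub0r /Th /= ifT; last by lra.
    by rewrite opprK h1.
  - move=> x x1; rewrite /h' /= mulr1 (_ : 2 - 1 = 1 :> R); last by lra.
    by rewrite Th_ge // k1 //; exact: bdY.
have [G eG] := extends_ex hT' aX' aX mg hh'.
have [mG GY Gin Gout] := eG.
exists h', G; split => //.
have mphi : maps (cube n) X (fun x => Phi (rho (4 *: x))).
  split.
    apply: (cont_on_comp (attach_cont aX)); last by move=> x _; exact: rho_norm.
    by apply: cont_on_rho; cont.
  move=> x _; rewrite (attach_eq aX); right; exists (rho (4 *: x)) => //.
  exact: rho_norm.
have mid : maps Y X id by split; [exact: cont_on_id|exact: XY].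
have norm4 (x : 'rV[R]_n) : `|4 *: x| = 4 * `|x| by rewrite normrZ ger0_norm.
have [|m [mm mY mPhi]] := glue_map hT aX mid mphi.
  by move=> x x1; rewrite rho_dir ?dirZ ?dir_id // norm4 x1 mulr1; lra.
(* For radius [r] at least 1/4, [G \o F] is [Th] at time [s r]: [3 - 8 * r] up to radius 1/2, where
   [F] is still the stretched cell and [G] runs through [h'], and [2 * r - 2] beyond, where [F] runs
   through [h]. This time goes from 1 down to -1 and back up to 0. Sliding it linearly to 1 undoes
   the detour, and at [r = 1] the slide is exactly [k]. *)
pose s (r : R) := Num.max (3 - 8 * r) (2 * r - 2).
pose phi p := if `|p.1| <= 4^-1 then Phi (4 *: p.1)
  else Th (dir p.1, (1 - clamp p.2) * s `|p.1| + clamp p.2).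
have q0 : (0 : R) < 4^-1 by lra.
have Phi4 x : 4^-1 <= `|x| -> Phi (rho (4 *: x)) = Th (dir x, 1).
  move=> x4; rewrite rho_dir ?dirZ //; last by rewrite norm4; lra.
  have d1 : `|dir x| = 1 by apply: norm_dir; exact: lt_le_trans x4.
  by rewrite Th_ge // k1 //; exact: bdY.
apply: (@htp_trans _ _ _ _ _ m).
- apply: (glue_htp (h := fun p => k (p.1, clamp p.2)) (phi := phi) hT aX).
  + by apply: (cont_on_comp ck); [cont; apply: cont_on_clamp; cont|move=> ? []].
  + by move=> y t Yy; apply: XY; exact: kY.
  + apply: cont_on_paste; first by cont.
    * apply: (cont_on_comp (attach_cont aX)); first by cont.
      by move=> [x t] [_ /= x4]; rewrite norm4; lra.
    * apply: (cont_on_comp cTh).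
        apply: cont_on_pair.
          apply: cont_on_dir; last by cont.
          by move=> [x t] [_ /= x4]; exact: lt_le_trans x4.
        rewrite /s; cont; apply: cont_on_clamp; cont.
      move=> [x t] [_ /= x4]; split => //=; apply: norm_dir.
      exact: lt_le_trans x4.
    * move=> [x t] _ /= x4; rewrite /s x4 max_l; last by lra.
      rewrite (_ : _ + _ = 1); last by lra.
      rewrite -Phi4 ?x4 // rho_id //; rewrite norm4; lra.
  + move=> x t x1; rewrite /phi /=; case: ifPn => [x4|].
      by rewrite (attach_eq aX); right; exists (4 *: x) => //=; rewrite norm4; lra.
    rewrite -ltNge => x4; apply: XY; apply: ThY; apply: norm_dir.
    exact: lt_trans x4.
  + move=> x t x1; rewrite /phi /= x1 ifF; last by apply/negbTE; rewrite -ltNge; lra.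
    rewrite /s max_r; last by lra.
    rewrite (_ : _ + _ = clamp t); last by lra.
    by rewrite dir_id // Th_ge // clamp_ge0.
  + by move=> y Yy; rewrite clamp0 // k0 //= FY // GY //; apply: (proj2 mf).
  + by move=> y Yy; rewrite clamp1 // k1 // mY.
  + move=> x x1; rewrite /phi /= clamp0 // subr0 mul1r addr0.
    have x2n : `|2 *: x| = 2 * `|x| by rewrite normrZ ger0_norm.
    case: ifPn => [x4|].
      rewrite Fin; last by lra.
      rewrite Gin; last by rewrite x2n; lra.
      by rewrite scalerA -natrM.
    rewrite -ltNge => x4; have [x2|x2] := leP `|x| 2^-1.
      rewrite Fin // Gout; last by rewrite x2n; apply/andP; split; lra.
      rewrite /h' /= dirZ // x2n /s max_l; last by lra.
      by congr (Th (_, _)); lra.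
    rewrite Fout; last by rewrite (ltW x2).
    rewrite GY; last by apply: hY; apply: norm_dir; lra.
    rewrite /s max_r; last by lra.
    rewrite /Th /= ifT; last by move: x1 => /=; lra.
    by congr (g (h (_, _))); lra.
  + move=> x x1; rewrite /phi /= clamp1 // subrr mul0r add0r mPhi //.
    case: ifPn => [x4|]; first by rewrite rho_id // norm4; lra.
    by rewrite -ltNge => /ltW /Phi4.
(* What is left is the identity on [Y] and the cell stretched by 4, then retracted; the factor
   decreases from 4 to 1. *)
- apply: (glue_htp (h := fst)
    (phi := fun p => Phi (rho ((4 - 3 * clamp p.2) *: p.1))) hT aX).
  + by cont.
  + by move=> y t; exact: XY.
  + apply: (cont_on_comp (attach_cont aX)); last by move=> p _; exact: rho_norm.
    by apply: cont_on_rho; cont; apply: cont_on_clamp; cont.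
  + move=> x t _; rewrite (attach_eq aX); right.
    by exists (rho ((4 - 3 * clamp t) *: x)) => //; exact: rho_norm.
  + move=> x t x1 /=; have := clamp_le1 t => t1.
    rewrite rho_dir ?dirZ ?dir_id //; first by lra.
    rewrite normrZ x1 mulr1 ger0_norm; lra.
  + by move=> y Yy; rewrite mY.
  + by [].
  + by move=> x x1; rewrite /= clamp0 // mulr0 subr0 mPhi.
  + move=> x x1; rewrite /= clamp1 // mulr1 (_ : 4 - 3 = 1 :> R); last by lra.
    by rewrite scale1r rho_id.
Qed.

End ExtensionInverse.

(* A left inverse of an extension is again an extension, so it has a left
   inverse too: hence it is a two-sided inverse, without any coherence between
   the two homotopies of the equivalence Y ~ Y'. *)
Lemma heq_attach (R : realType) (T T' : topologicalType) n
    (Y X : set T) (Phi : 'rV[R]_n -> T) (Y' X' : set T') (Phi' : 'rV[R]_n -> T')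
    (f : T -> T') (g : T' -> T) :
  hausdorff_space T -> hausdorff_space T' ->
  attach Y X Phi -> attach Y' X' Phi' ->
  maps Y Y' f -> maps Y' Y g ->
  htp R Y Y (g \o f) id -> htp R Y' Y' (f \o g) id ->
  htp R (bdcube n) Y' (f \o Phi) Phi' ->
  heq R X X'.
Proof.
move=> hT hT' aX aX' mf mg gf fg [h hh].
have [F eF] := extends_ex hT aX aX' mf hh.
have [h' [G [hh' eG GF]]] := extends_linv hT hT' aX aX' mf mg gf hh eF.
have [h'' [F' [_ eF' F'G]]] := extends_linv hT' hT aX' aX mg mf fg hh' eG.
have [[mF _ _ _] [mG _ _ _] [mF' _ _ _]] := And3 eF eG eF'.
exists F, G; split => //.
have F'F : htp R X X' F F'.
  apply: (@htp_trans _ _ _ _ _ (F' \o G \o F)).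
    by apply: htp_sym; have := htp_pre F'G mF.
  by have := htp_post GF mF'.
by apply: htp_trans F'G; have := htp_pre F'F mG.
Qed.

(** * Cubes and spheres *)

Section MaxNorm.
Context {R : realType} {n : nat}.
Implicit Types x : 'rV[R]_n.

Lemma rV_norm_le x (c : R) : 0 <= c ->
  (`|x| <= c) <-> (forall i, `|x ord0 i| <= c).
Proof.
move=> c0; rewrite {1}/Num.norm /= mx_normrE; split => [/bigmax_leP[_ h] i|h].
  exact: (h (ord0, i)).
by apply/bigmax_leP; split => // -[i j] _; rewrite ord1; exact: h.
Qed.

Lemma rV_norm_lt x (c : R) : 0 < c ->
  (`|x| < c) <-> (forall i, `|x ord0 i| < c).
Proof.
move=> c0; rewrite {1}/Num.norm /= mx_normrE; split => [/bigmax_ltP[_ h] i|h].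
  exact: (h (ord0, i)).
by apply/bigmax_ltP; split => // -[i j] _; rewrite ord1; exact: h.
Qed.

Lemma rV_norm_eq1 x : `|x| = 1 -> exists i, `|x ord0 i| = 1.
Proof.
move=> x1; apply: contrapT => /forallNP h.
have : `|x| < 1.
  apply/(rV_norm_lt _ ltr01) => i; rewrite lt_neqAle; apply/andP; split.
    by apply/eqP; exact: h.
  by move: i; apply/(rV_norm_le _ ler01); rewrite x1.
by rewrite x1 ltxx.
Qed.

Lemma rV_norm_const1 : (0 < n)%N -> `|const_mx 1 : 'rV[R]_n| = 1.
Proof.
move=> n0; apply/le_anti/andP; split.
  by apply/(rV_norm_le _ ler01) => i; rewrite mxE normr1.
rewrite leNgt; apply/negP => /(rV_norm_lt _ ltr01) /(_ (Ordinal n0)).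
by rewrite mxE normr1 ltxx.
Qed.

End MaxNorm.

Lemma injective_hausdorff (T U : topologicalType) (f : T -> U) :
  injective f -> continuous f -> hausdorff_space U -> hausdorff_space T.
Proof.
move=> fI cf hU x y clxy; apply/fI/hU => A B /cf nA /cf nB.
by have [z [? ?]] := clxy _ _ nA nB; exists (f z).
Qed.

(* The quotient map cube / boundary = sphere: x |-> x / (1 - |x|) followed by
   the inverse stereographic projection from the base point. *)
Section Kappa.
Context {R : realType} {n : nat}.
Implicit Types x y : 'rV[R]_n.

Definition sqn x : R := \sum_i x ord0 i ^+ 2.

(** The denominator of inverse stereographic projection at [x / (1 - |x|)], multiplied by
    [(1 - |x|) ^+ 2]. It never vanishes, so [kappa] is defined on the boundary too. Here [|x|] is
    the max norm, whereas [sqn] is the Euclidean square. *)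
Definition kden x : R := sqn x + (1 - `|x|) ^+ 2.

Definition kappa x : 'rV[R]_n.+1 :=
  \row_i oapp (fun j => 2 * (1 - `|x|) * x ord0 j / kden x)
    ((sqn x - (1 - `|x|) ^+ 2) / kden x) (unlift ord0 i).

Lemma kappa0E x : kappa x ord0 ord0 = (sqn x - (1 - `|x|) ^+ 2) / kden x.
Proof. by rewrite mxE unlift_none. Qed.

Lemma kappaSE x j :
  kappa x ord0 (lift ord0 j) = 2 * (1 - `|x|) * x ord0 j / kden x.
Proof. by rewrite mxE liftK. Qed.

Lemma sqn_ge0 x : 0 <= sqn x.
Proof. by apply: sumr_ge0 => i _; exact: sqr_ge0. Qed.

Lemma sqn_eq0 x : sqn x = 0 -> x = 0.
Proof.
move=> /eqP; rewrite psumr_eq0; last by move=> i _; exact: sqr_ge0.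
move=> /allP h; apply/rowP => i; rewrite mxE; apply/eqP.
by rewrite -sqrf_eq0; apply: h; exact: mem_index_enum.
Qed.

Lemma sqnZ (a : R) x : sqn (a *: x) = a ^+ 2 * sqn x.
Proof. by rewrite /sqn mulr_sumr; apply: eq_bigr => i _; rewrite mxE exprMn. Qed.

Lemma kden_gt0 x : 0 < kden x.
Proof.
rewrite lt_neqAle addr_ge0 ?sqn_ge0 ?sqr_ge0 // andbT eq_sym.
rewrite /kden paddr_eq0 ?sqn_ge0 ?sqr_ge0 //; apply/negP => /andP[/eqP/sqn_eq0 ->].
by rewrite normr0 subr0 expr1n oner_eq0.
Qed.

Lemma kappa_sphere x : sphere R n (kappa x).
Proof.
have D0 := lt0r_neq0 (kden_gt0 x).
rewrite /sphere /= big_ord_recl kappa0E.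
rewrite (eq_bigr (fun j => (2 * (1 - `|x|) / kden x) ^+ 2 * x ord0 j ^+ 2)).
  rewrite -mulr_sumr -/(sqn x); apply: (mulfI (expf_neq0 2 D0)).
  rewrite mulr1 mulrDr !expr_div_n mulrCA mulfV ?expf_neq0 // mulr1.
  rewrite mulrA mulrCA mulfV ?expf_neq0 // mulr1 /kden; ring.
by move=> j _; rewrite kappaSE; field.
Qed.

Lemma cont_on_kappa (T : topologicalType) (A : set T) (f : T -> 'rV[R]_n) :
  cont_on A f -> cont_on A (fun t => kappa (f t)).
Proof.
move=> cf; apply: cont_on_row => i.
have cD : cont_on A (fun t => (kden (f t))^-1).
  apply: cont_onV => [t _|]; first exact/lt0r_neq0/kden_gt0.
  by rewrite /kden /sqn; cont.
case: (unliftP ord0 i) => [j|] ->.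
  apply: (@cont_on_eq _ _ _
    (fun t => 2 * (1 - `|f t|) * f t ord0 j / kden (f t))).
    by move=> t _; rewrite kappaSE.
  by cont.
apply: (@cont_on_eq _ _ _
  (fun t => (sqn (f t) - (1 - `|f t|) ^+ 2) / kden (f t))).
  by move=> t _; rewrite kappa0E.
by rewrite /sqn; cont.
Qed.

Lemma kappa_bd x : `|x| = 1 -> kappa x = delta_mx ord0 ord0.
Proof.
move=> x1; have := kden_gt0 x; rewrite /kden x1 subrr expr0n addr0 => /lt0r_neq0 x0.
apply/rowP => i; rewrite [RHS]mxE /=; case: (unliftP ord0 i) => [j|] ->.
  by rewrite kappaSE x1 subrr mulr0 !mul0r.
by rewrite kappa0E /kden x1 subrr expr0n addr0 subr0 divff.
Qed.

Lemma kappa0_lt1 x : `|x| < 1 -> kappa x ord0 ord0 < 1.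
Proof.
move=> x1; rewrite kappa0E ltr_pdivrMr ?kden_gt0 // mul1r /kden.
have : 0 < (1 - `|x|) ^+ 2 by rewrite exprn_gt0 // subr_gt0.
lra.
Qed.

Lemma kappa_stereo x : `|x| < 1 ->
  x = (1 - `|x|) *: \row_j (kappa x ord0 (lift ord0 j) / (1 - kappa x ord0 ord0)).
Proof.
move=> x1; have D0 := lt0r_neq0 (kden_gt0 x).
have m0 : 1 - `|x| != 0 by rewrite gt_eqF // subr_gt0.
apply/rowP => j; rewrite 2!mxE kappaSE kappa0E.
have -> : 1 - (sqn x - (1 - `|x|) ^+ 2) / kden x = 2 * (1 - `|x|) ^+ 2 / kden x.
  by rewrite -{1}(divff D0) -mulrBl /kden; congr (_ / _); ring.
by field; rewrite D0 m0.
Qed.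

(** Stereographic projection [z] determines [x] up to the factor [1 - |x|], and taking norms in
    [x = (1 - |x|) z] determines [|x|]. *)
Lemma kappa_inj x y : `|x| < 1 -> `|y| < 1 -> kappa x = kappa y -> x = y.
Proof.
move=> x1 y1 E; have := kappa_stereo x1; have := kappa_stereo y1.
rewrite -E; set z := \row__ _ => Ey Ex.
suff m : `|x| = `|y| by rewrite Ex Ey m.
have nz (t : 'rV[R]_n) : `|t| < 1 -> t = (1 - `|t|) *: z -> `|t| = (1 - `|t|) * `|z|.
  by move=> t1 {1}->; rewrite normrZ ger0_norm // subr_ge0 ltW.
have ex := nz _ x1 Ex; have ey := nz _ y1 Ey.
have z0 : 0 < 1 + `|z| by apply: ltr_pwDl.
apply: (mulIf (lt0r_neq0 z0)).
have -> : `|x| * (1 + `|z|) = `|z| by lra.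
by lra.
Qed.

Lemma kappa_surj (w : 'rV[R]_n.+1) : sphere R n w ->
  w != delta_mx ord0 ord0 -> exists2 x, `|x| < 1 & kappa x = w.
Proof.
rewrite /sphere /= big_ord_recl => sw wb; set a := w ord0 ord0 in sw *.
pose v : 'rV[R]_n := \row_j w ord0 (lift ord0 j).
have sv : sqn v = 1 - a ^+ 2.
  by rewrite -sw addrC addKr /sqn; apply: eq_bigr => j _; rewrite mxE.
have a1 : a < 1.
  rewrite lt_neqAle; apply/andP; split; last first.
    by have := sqn_ge0 v; rewrite sv; nra.
  apply: contra wb => /eqP a1; apply/eqP/rowP => i; rewrite [RHS]mxE /=.
  have v0 : v = 0 by apply: sqn_eq0; rewrite sv a1; ring.
  case: (unliftP ord0 i) => [j|] ->; last by rewrite eqxx.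
  by move/rowP: v0 => /(_ j); rewrite !mxE.
have a1' : 1 - a != 0 by rewrite gt_eqF // subr_gt0.
pose z := (1 - a)^-1 *: v.
have sz : sqn z = (1 + a) / (1 - a).
  by rewrite sqnZ sv; field.
(* The solution of [1 - |m z| = m], so that [m *: z] is the cube point lying over [z]. *)
pose m := (1 + `|z|)^-1.
have z0 : 0 < 1 + `|z| by apply: ltr_pwDl.
have m0 : 0 < m by rewrite invr_gt0.
have nx : 1 - `|m *: z| = m.
  rewrite normrZ gtr0_norm //; apply: (mulfI (lt0r_neq0 z0)).
  by rewrite /m; field; exact: lt0r_neq0.
exists (m *: z); first by rewrite -subr_gt0 nx.
have D : kden (m *: z) = m ^+ 2 * (2 / (1 - a)).
  by rewrite /kden nx sqnZ sz; field.
have m0' := lt0r_neq0 m0.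
apply/rowP => i; case: (unliftP ord0 i) => [j|] ->.
  by rewrite kappaSE nx D !mxE; field; rewrite m0' a1'.
by rewrite kappa0E nx D sqnZ sz -/a; field; rewrite m0' a1'.
Qed.

(** In dimension 0 the cube has no boundary point to hit the base point. *)
Lemma cube_surj_sphere (w : 'rV[R]_n.+1) : (0 < n)%N -> sphere R n w ->
  exists2 x, cube n x & kappa x = w.
Proof.
move=> n0 sw; have [->|/(kappa_surj sw)[x x1 <-]] := eqVneq w (delta_mx ord0 ord0).
  exists (const_mx 1); first by rewrite /= rV_norm_const1.
  by rewrite kappa_bd // rV_norm_const1.
by exists x => //; exact: ltW.
Qed.

Definition kappaS x : sphere R n := SigSub (mem_set (kappa_sphere x)).

Lemma continuous_kappaS : continuous kappaS.
Proof.
apply: continuous_comp_initial => x W /= nW.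
have := cont_on_kappa (@cont_on_id _ setT) I nW.
by apply: filterS => y; apply.
Qed.

End Kappa.

(** * Subwedges of a wedge of spheres *)

Section WedgePart.
Context {R : realType} (k : nat) (u : nat -> nat).

Let W : topologicalType := wedge_of_spheres R (fun i : 'I_k.+1 => u i).

Let p0 (i : 'I_k.+1) : sphere R (u i) := sphere_base R (u i).

Definition wlift (i : 'I_k.+1) : sphere R (u i) -> W :=
  @wedge_lift _ _ p0 i.

Definition wbase : W := wlift (p0 ord0).

Lemma wlift_base i : wlift (p0 i) = wbase.
Proof. exact: (@wedge_liftE _ _ p0 ord0 (p0 ord0) i (p0 i)). Qed.

(** The coordinates in the product of all the spheres separate points of the wedge, within one
    sphere and across two. *)
Lemma wedge_prod_lift (i : 'I_k.+1) (s : sphere R (u i)) :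
  wedge_prod (wlift s) = dfwith p0 i s.
Proof. exact: wedge_lift_funE (@wedge_prod_pointE _ _ p0). Qed.

Lemma wlift_inj i : injective (@wlift i).
Proof.
move=> s t /(congr1 (fun w => wedge_prod w i)).
by rewrite !wedge_prod_lift !dfwithin.
Qed.

Lemma wlift_neq (i j : 'I_k.+1) (s : sphere R (u i)) (t : sphere R (u j)) :
  i != j -> wlift s = wlift t -> s = p0 i.
Proof.
move=> ij /(congr1 (fun w => wedge_prod w i)).
by rewrite !wedge_prod_lift dfwithin dfwithout // eq_sym.
Qed.

Lemma hausdorff_wedge_of_spheres : hausdorff_space W.
Proof.
apply: wedge_hausdorff => i.
apply: (@injective_hausdorff _ _ set_val); first exact: val_inj.
  exact: initial_continuous.
exact: norm_hausdorff.
Qed.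

Definition wcell (i : 'I_k.+1) (x : 'rV[R]_(u i)) : W := wlift (kappaS x).

Lemma continuous_wcell i : continuous (@wcell i).
Proof.
move=> x; apply: (@continuous_comp _ _ _ (@kappaS R (u i)) (@wlift i)).
  exact: continuous_kappaS.
exact: (@wedge_lift_continuous _ _ p0).
Qed.

Lemma kappaS_bd n (x : 'rV[R]_n) : `|x| = 1 -> kappaS x = sphere_base R n.
Proof. by move=> x1; apply: val_inj; exact: kappa_bd. Qed.

Lemma wcell_bd (i : 'I_k.+1) (x : 'rV[R]_(u i)) : `|x| = 1 -> wcell x = wbase.
Proof. by move=> x1; rewrite /wcell kappaS_bd // -(wlift_base i). Qed.

(** The base point is listed separately so that the part with no sphere is a point. *)
Definition wpart (j : nat) : set W :=
  [set w | w = wbase \/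
           exists i : 'I_k.+1, (i < j)%N /\ exists s : sphere R (u i), w = wlift s].

Lemma kappaS_surj n (s : sphere R n) :
  s = sphere_base R n \/ exists2 x : 'rV[R]_n, cube n x & kappaS x = s.
Proof.
have [E|NE] := eqVneq (val s) (val (sphere_base R n)).
  by left; exact: val_inj.
have [x x1 xs] := kappa_surj (set_mem (valP s)) NE.
by right; exists x; [exact: ltW|exact: val_inj].
Qed.

Lemma wpartS (j : 'I_k.+1) : wpart j.+1 = wpart j `|` @wcell j @` cube (u j).
Proof.
apply/seteqP; split => w.
  move=> [->|[i [ij [s ->]]]]; first by left; left.
  move: ij; rewrite ltnS leq_eqVlt => /orP[/eqP/val_inj E|ij].
    rewrite {}E in s *; have [->|[x x1 <-]] := kappaS_surj s.
      by left; left; exact: wlift_base.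
    by right; exists x.
  by left; right; exists i; split => //; exists s.
move=> [[->|[i [ij [s ->]]]]|[x x1 <-]]; first by left.
- by right; exists i; split; [exact: ltnW|exists s].
- by right; exists j; split => //; exists (kappaS x).
Qed.

Lemma compact_wpart j : (j <= k.+1)%N -> compact (wpart j).
Proof.
elim: j => [_|j IH jk].
  have -> : wpart 0 = [set wbase]; last exact: compact_set1.
  by apply/seteqP; split => w; [move=> [//|[i []]]|move=> ->; left].
rewrite (wpartS (Ordinal jk)); apply: compactU; first by apply: IH; exact: ltnW.
apply: continuous_compact; last exact: compact_cube.
by apply: continuous_subspaceT; exact: continuous_wcell.
Qed.

Lemma attach_wpart (j : 'I_k.+1) : attach (wpart j) (wpart j.+1) (@wcell j).
Proof.
split.
- by apply: compact_wpart; exact: ltnW.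
- by apply: continuous_cont_on; exact: continuous_wcell.
- by move=> x /wcell_bd ->; left.
- move=> x y x1 y1 /wlift_inj /(congr1 val) /=; exact: kappa_inj.
- move=> x x1 Wx.
  suff : kappaS x = p0 j.
    move=> /(congr1 (fun s => (val s : 'rV_ _) ord0 ord0)) /=; apply/eqP.
    by rewrite [X in _ == X]mxE !eqxx lt_eqF // kappa0_lt1.
  case: Wx => [|[i [ij [s]]]].
    by rewrite -(wlift_base j) => /wlift_inj.
  apply: wlift_neq; apply/eqP => E; move: ij; by rewrite E ltnn.
- exact: wpartS.
Qed.

(** A segment in the cube from a preimage of [w] to the corner [const_mx 1] ends over the base
    point. Positive dimension is needed: the 0-sphere is not connected. *)
Lemma wpart_path (j : nat) (w : W) (T : topologicalType) (A : set T) :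
  (forall i : 'I_k.+1, (i < j)%N -> (0 < u i)%N) -> wpart j w ->
  htp R A (wpart j) (fun=> w) (fun=> wbase).
Proof.
move=> u0 [->|[i [ij [s ->]]]].
  by apply: htp_eq => //; split; [exact: cont_on_cst|left].
have [->|[x x1 <-]] := kappaS_surj s.
  by rewrite wlift_base; apply: htp_eq => //; split; [exact: cont_on_cst|left].
exists (fun p => wcell ((1 - p.2) *: x + p.2 *: const_mx 1)); split => /=.
- by apply: cont_on_compc; [exact: continuous_wcell|cont].
- move=> _ t _; right; exists i; split => //.
  by exists (kappaS ((1 - t) *: x + t *: const_mx 1)).
- by move=> _ _; rewrite subr0 scale1r scale0r addr0.
- move=> _ _; rewrite subrr scale0r scale1r add0r wcell_bd //.
  by rewrite rV_norm_const1 // u0.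
Qed.

Lemma wpart_full : wpart k.+1 = setT.
Proof.
apply/seteqP; split => // w _; right.
have : [set: W] w by []; rewrite -(wedgeTE p0) => -[i _ [s _ <-]].
by exists i; split; [exact: ltn_ord|exists s].
Qed.

End WedgePart.

(** * Sets equivalent to a wedge of spheres *)

Section Spherical.
Context {R : realType}.

(* The dimensions beyond the first j are left open, so that the target can
   be extended by further spheres without changing the ambient wedge. *)
Definition spherical (m : nat) (T : topologicalType) (Y : set T) : Prop :=
  exists (j : nat) (u0 : nat -> nat),
    [/\ (m <= j)%N, forall i, (i < j)%N -> (0 < u0 i)%N &
      forall k u, (j <= k.+1)%N -> (forall i, (i < j)%N -> u i = u0 i) ->
        heq R Y (@wpart R k u j)].

Lemma spherical_weaken m m' (T : topologicalType) (Y : set T) :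
  (m' <= m)%N -> spherical m Y -> spherical m' Y.
Proof.
by move=> mm [j [u0 [mj u0P h]]]; exists j, u0; split=> //; exact: leq_trans mj.
Qed.

Lemma spherical_heq m (T U : topologicalType) (Y : set T) (Z : set U) :
  heq R Y Z -> spherical m Y -> spherical m Z.
Proof.
move=> YZ [j [u0 [mj u0P h]]]; exists j, u0; split=> // k u jk uu0.
by apply: heq_trans (h k u jk uu0); exact: heq_sym.
Qed.

Lemma spherical_contractible (T : topologicalType) (Y : set T) (y0 : T) :
  Y y0 -> htp R Y Y id (fun=> y0) -> spherical 0 Y.
Proof.
move=> Yy0 hY; exists 0%N, (fun=> 0%N); split => // k u _ _.
have E : @wpart R k u 0 = [set wbase k u].
  by apply/seteqP; split => w; [move=> [//|[i []]]|move=> ->; left].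
exists (fun=> wbase k u), (fun=> y0); rewrite E; split => //.
- by split; [exact: cont_on_cst|].
- by split; [exact: cont_on_cst|].
- exact: htp_sym.
- by apply: htp_eq => [|_ ->//]; split; [exact: cont_on_cst|].
Qed.

(** The cell of a wedge is attached by a constant map, so [heq_attach] applies once [f \o Phi] is
    deformed to the constant [f y0] and this point is moved to the base point. *)
Lemma spherical_attach m (T : topologicalType) n (Y X : set T)
    (Phi : 'rV[R]_n -> T) (y0 : T) :
  hausdorff_space T -> (0 < n)%N -> attach Y X Phi -> Y y0 ->
  htp R (bdcube n) Y Phi (fun=> y0) ->
  spherical m Y -> spherical m.+1 X.
Proof.
move=> hT n0 aX Yy0 nPhi [j [u0 [mj u0P hY]]].
(* Only the value at index [j] is new: it records the dimension of the attached cell. *)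
exists j.+1, (fun i => if (i < j)%N then u0 i else n); split => //.
  by move=> i _; case: ifP => [/u0P|].
move=> k u jk uu0.
have uj : u j = n by rewrite uu0 // ltnn.
have uu0' i : (i < j)%N -> u i = u0 i.
  by move=> ij; rewrite uu0 ?ij //; exact: ltnW.
have [f [g [mf mg gf fg]]] := hY k u (ltnW jk) uu0'.
pose i := Ordinal jk.
have E : u i = n by [].
subst n.
apply: (heq_attach hT (@hausdorff_wedge_of_spheres R k u) aX
  (attach_wpart u i) mf mg gf fg).
apply: (@htp_trans _ _ _ _ _ (fun=> f y0)).
  by have := htp_post nPhi mf.
apply: (@htp_trans _ _ _ _ _ (fun=> wbase k u)).
  apply: wpart_path; last by apply: (proj2 mf).
  by move=> i' ij; rewrite uu0' // u0P.
apply: htp_eq => [|x x1]; first by split; [exact: cont_on_cst|left].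
by rewrite wcell_bd.
Qed.

End Spherical.

(** * Attaching a product of a cell and a torus *)

Section ConsRow.
Context {R : realType} {n : nat}.
Implicit Types (x : 'rV[R]_n.+1) (t : R) (d : 'rV[R]_n).

Definition row_hd x : R := x ord0 ord0.

Definition row_tl x : 'rV[R]_n := \row_j x ord0 (lift ord0 j).

Definition cons_row t d : 'rV[R]_n.+1 :=
  \row_i oapp (fun j => d ord0 j) t (unlift ord0 i).

Lemma row_hd_cons t d : row_hd (cons_row t d) = t.
Proof. by rewrite /row_hd mxE unlift_none. Qed.

Lemma row_tl_cons t d : row_tl (cons_row t d) = d.
Proof. by apply/rowP => j; rewrite !mxE liftK. Qed.

Lemma row_split_eq x y : row_hd x = row_hd y -> row_tl x = row_tl y -> x = y.
Proof.
move=> h /rowP t; apply/rowP => i; case: (unliftP ord0 i) => [j|] ->; last exact: h.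
by have := t j; rewrite !mxE.
Qed.

Lemma norm_split_le x : `|x| <= 1 <-> `|row_hd x| <= 1 /\ `|row_tl x| <= 1.
Proof.
rewrite !(rV_norm_le _ ler01); split=> [h|[h t] i].
  by split => [|j]; [exact: h|rewrite mxE; exact: h].
by case: (unliftP ord0 i) => [j|] -> //; have := t j; rewrite mxE.
Qed.

Lemma norm_split_lt x : `|x| < 1 <-> `|row_hd x| < 1 /\ `|row_tl x| < 1.
Proof.
rewrite !(rV_norm_lt _ ltr01); split=> [h|[h t] i].
  by split => [|j]; [exact: h|rewrite mxE; exact: h].
by case: (unliftP ord0 i) => [j|] -> //; have := t j; rewrite mxE.
Qed.

Lemma norm_split_eq1 x : `|x| = 1 ->
  [/\ `|row_hd x| <= 1, `|row_tl x| <= 1 & `|row_hd x| = 1 \/ `|row_tl x| = 1].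
Proof.
move=> x1; have [h t] : `|row_hd x| <= 1 /\ `|row_tl x| <= 1.
  by apply/norm_split_le; rewrite x1.
split => //; apply: contrapT => /not_orP[/eqP h1 /eqP t1].
suff : `|x| < 1 by rewrite x1 ltxx.
by apply/norm_split_lt; rewrite !lt_neqAle h t h1 t1.
Qed.

Lemma cont_on_row_hd (T : topologicalType) (A : set T) (f : T -> 'rV[R]_n.+1) :
  cont_on A f -> cont_on A (fun z => row_hd (f z)).
Proof. exact: cont_on_coord. Qed.

Lemma cont_on_row_tl (T : topologicalType) (A : set T) (f : T -> 'rV[R]_n.+1) :
  cont_on A f -> cont_on A (fun z => row_tl (f z)).
Proof.
move=> cf; apply: cont_on_row => i.
apply: (@cont_on_eq _ _ _ (fun z => f z ord0 (lift ord0 i))); last by cont.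
by move=> z _; rewrite mxE.
Qed.

End ConsRow.

Section Circle.
Context {R : realType}.

Definition circle : topologicalType := sphere R 1.

Definition circle_base : circle := sphere_base R 1.

Definition circle_map (t : R) : circle := kappaS (const_mx t : 'rV[R]_1).

Let norm1 (t : R) : `|const_mx t : 'rV[R]_1| = `|t|.
Proof.
apply/le_anti/andP; split.
  by apply/rV_norm_le => // i; rewrite mxE.
rewrite leNgt; apply/negP; have [->|t0] := eqVneq t 0.
  by rewrite -[const_mx 0]/(0 : 'rV[R]_1) !normr0 ltxx.
move/(rV_norm_lt _ (_ : 0 < `|t|)) => /(_ _ ord0); rewrite normr_gt0 => /(_ t0).
by rewrite mxE ltxx.
Qed.

Lemma circle_map_bd t : `|t| = 1 -> circle_map t = circle_base.
Proof. by move=> t1; apply: kappaS_bd; rewrite norm1. Qed.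

Lemma circle_map_neq t : `|t| < 1 -> circle_map t <> circle_base.
Proof.
move=> t1 /(congr1 (fun s => (val s : 'rV_ _) ord0 ord0)) /=; apply/eqP.
by rewrite [X in _ == X]mxE !eqxx lt_eqF // kappa0_lt1 // norm1.
Qed.

Lemma circle_map_inj t t' : `|t| < 1 -> `|t'| < 1 ->
  circle_map t = circle_map t' -> t = t'.
Proof.
move=> t1 t1' /(congr1 val) /= /kappa_inj; rewrite !norm1 => /(_ t1 t1').
by move=> /rowP /(_ ord0); rewrite !mxE.
Qed.

Lemma circle_map_surj (s : circle) : exists2 t, `|t| <= 1 & circle_map t = s.
Proof.
have [x x1 xs] := @cube_surj_sphere R 1 (val s) isT (set_mem (valP s)).
exists (x ord0 ord0); first by move: x1 => /(rV_norm_le _ ler01); exact.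
apply: val_inj; rewrite /= -xs; congr kappa; apply/rowP => i.
by rewrite mxE (ord1 i).
Qed.

Lemma continuous_circle_map : continuous circle_map.
Proof.
move=> t; apply: (@continuous_comp _ _ _ (fun t => const_mx t : 'rV[R]_1) (@kappaS R 1)).
  have c : cont_on setT (fun t : R => const_mx t : 'rV[R]_1).
    apply: cont_on_row => i; apply: cont_on_eq (@cont_on_id _ _) => y _.
    by rewrite mxE.
  by move=> W /(c t I); apply: filterS => y; apply.
exact: continuous_kappaS.
Qed.

Lemma compact_circle : compact [set: circle].
Proof.
have -> : [set: circle] = circle_map @` `[-1, 1].
  apply/seteqP; split => // s _; have [t t1 <-] := circle_map_surj s.
  by exists t => //=; rewrite in_itv /= -ler_norml.
apply: continuous_compact; last exact: segment_compact.
by apply: continuous_subspaceT; exact: continuous_circle_map.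
Qed.

End Circle.
Arguments circle : clear implicits.

Section Chunks.
Context {R : realType}.

(** [attach] for a whole family of cells. The parameter space [B] has no boundary: the cube
    coordinate alone decides whether a point falls into [Y]. *)
Record chunk (B T : topologicalType) n (Y X : set T)
    (Phi : 'rV[R]_n * B -> T) : Prop := Chunk {
  chunk_compact : compact Y;
  chunk_cont : cont_on (cube n `*` setT) Phi;
  chunk_bd : forall x b, `|x| = 1 -> Y (Phi (x, b));
  chunk_inj : forall x y b c, `|x| < 1 -> `|y| < 1 ->
    Phi (x, b) = Phi (y, c) -> x = y /\ b = c;
  chunk_out : forall x b, `|x| < 1 -> ~ Y (Phi (x, b));
  chunk_eq : X = Y `|` Phi @` (cube n `*` setT) }.

(** A property of [B] alone, quantified over all cell dimensions, so that it can be proved by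
    induction on circle factors. The count of spheres is a lower bound, kept to know in the end that
    there is at least one. *)
Definition chunkable (B : topologicalType) : Prop :=
  forall (T : topologicalType) n m (Y X : set T) (Phi : 'rV[R]_n * B -> T) y0,
    hausdorff_space T -> (0 < n)%N -> chunk Y X Phi -> Y y0 ->
    htp R (bdcube n `*` setT) Y Phi (fun=> y0) ->
    spherical (R := R) m Y -> spherical (R := R) m.+1 X.

Lemma chunkable_point : chunkable 'rV[R]_0.
Proof.
move=> T n m Y X Phi y0 hT n0 [cY cPhi bd inj out eX] Yy0 nPhi.
apply: (spherical_attach (Phi := fun x => Phi (x, 0)) hT n0 _ Yy0).
  split => //.
  - by apply: (cont_on_comp cPhi); [cont|].
  - by move=> x /bd.
  - by move=> x y x1 y1 /inj[].
  - by move=> x /out.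
  - rewrite eX; congr (_ `|` _); apply/seteqP; split => z.
      by move=> [[x b] [/= x1 _] <-]; exists x; rewrite // [b]thinmx0.
    by move=> [x x1 <-]; exists (x, 0).
apply: (htp_pre (h := fun x => (x, 0 : 'rV[R]_0)) nPhi).
by split; [cont|].
Qed.

Section ChunkCircle.
Context {B T : topologicalType} {n : nat} {Y X : set T}.
Context {Phi : 'rV[R]_n * (B * circle R) -> T} {y0 : T}.
Hypotheses (cB : compact [set: B]) (aX : chunk Y X Phi).

Definition chunk_base (p : 'rV[R]_n * B) : T := Phi (p.1, (p.2, circle_base)).

(** The circle coordinate is cut open at the base point and becomes the head of a cube of dimension
    one higher; its faces at -1 and 1 land in [chunk_mid]. *)
Definition chunk_next (p : 'rV[R]_n.+1 * B) : T :=
  Phi (row_tl p.1, (p.2, circle_map (row_hd p.1))).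

Definition chunk_mid : set T := Y `|` chunk_base @` (cube n `*` setT).

Lemma cont_on_chunk_base : cont_on (cube n `*` setT) chunk_base.
Proof. by apply: (cont_on_comp (chunk_cont aX)); [cont|move=> ? []]. Qed.

Lemma chunk_chunk_base : chunk Y chunk_mid chunk_base.
Proof.
case: aX => cY cPhi bd inj out eX; split => //.
- exact: cont_on_chunk_base.
- by move=> x b x1; exact: bd.
- by move=> x y b c x1 y1 /(inj _ _ _ _ x1 y1) /= [-> [->]].
- by move=> x b x1; exact: out.
Qed.

Lemma chunk_chunk_next : chunk chunk_mid X chunk_next.
Proof.
case: aX => cY cPhi bd inj out eX; split => //.
- apply: compactU => //; apply: continuous_compact.
    by apply/cont_onP; exact: cont_on_chunk_base.
  by apply: compact_setX => //; exact: compact_cube.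
- apply: (cont_on_comp cPhi).
    apply: cont_on_pair; first by apply: cont_on_row_tl; cont.
    apply: cont_on_pair; first by cont.
    apply: cont_on_compc; first exact: continuous_circle_map.
    by apply: cont_on_row_hd; cont.
  by move=> [x b] [/= /norm_split_le[_ t1] _].
- move=> x b /norm_split_eq1[h1 t1 [h|t]]; last by left; exact: bd.
  by right; exists (row_tl x, b) => //; rewrite /chunk_next /= circle_map_bd.
- move=> x y b c /norm_split_lt[hx tx] /norm_split_lt[hy ty].
  move=> /(inj _ _ _ _ tx ty) /= [E Eb]; split; last exact: (congr1 fst Eb).
  by apply: row_split_eq => //; exact: circle_map_inj hx hy (congr1 snd Eb).
- move=> x b /norm_split_lt[hx tx] [|[[y c] [/= y1 _]]]; first exact: out.
  rewrite /chunk_base /chunk_next /=; move: y1; rewrite le_eqVlt => /predU1P[y1 E|y1].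
    by apply: (out _ (b, circle_map (row_hd x)) tx); rewrite -E; exact: bd.
  by move=> /(inj _ _ _ _ y1 tx) [_ /(congr1 snd) /= /esym]; exact: circle_map_neq.
- rewrite eX; apply/seteqP; split => z.
    move=> [Yz|[[d [b s]] [/= d1 _] <-]]; first by left; left.
    have [t t1 <-] := circle_map_surj s.
    right; exists (cons_row t d, b).
      by split => //=; apply/norm_split_le; rewrite row_hd_cons row_tl_cons.
    by rewrite /chunk_next /= row_hd_cons row_tl_cons.
  move=> [[Yz|[[d b] [/= d1 _] <-]]|[[x b] [/= /norm_split_le[_ t1] _] <-]].
  - by left.
  - by right; exists (d, (b, circle_base)).
  - by right; exists (row_tl x, (b, circle_map (row_hd x))).
Qed.

Lemma chunk_next_null : (0 < n)%N ->
  htp R (bdcube n `*` setT) Y Phi (fun=> y0) ->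
  htp R (bdcube n.+1 `*` setT) chunk_mid chunk_next (fun=> y0).
Proof.
case: aX => cY cPhi bd inj out eX n0 [H [cH HY H0 H1]].
have H0' d c : `|d| = 1 -> H (d, c, 0) = Phi (d, c) by move=> d1; exact: H0.
have H1' d c : `|d| = 1 -> H (d, c, 1) = y0 by move=> d1; exact: H1.
(* Homotopy extension from the boundary to the whole cube: at stage [q], growing from 1 to 2, the
   cell is squeezed into radius [1 / q] and the collar outside runs along [H]. At time 1 the
   boundary of the cube goes to [y0]. *)
pose K p : T := let q := 1 + clamp p.2 in
  if q * `|p.1.1| <= 1 then Phi (q *: p.1.1, p.1.2)
  else H (dir p.1.1, p.1.2, q * `|p.1.1| - 1).
have q1 (v : R) : 1 <= 1 + clamp v by have := clamp_ge0 v; lra.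
have q2 (v : R) : 1 + clamp v <= 2 by have := clamp_le1 v; lra.
have q0 (v : R) : 0 < 1 + clamp v by exact: lt_le_trans (q1 v).
have pos d (v : R) : 1 <= (1 + clamp v) * `|d : 'rV[R]_n| -> 0 < `|d|.
  by move=> h; rewrite -(pmulr_rgt0 _ (q0 v)); exact: lt_le_trans h.
have nq d (v : R) : `|(1 + clamp v) *: d : 'rV[R]_n| = (1 + clamp v) * `|d|.
  by rewrite normrZ gtr0_norm.
have cK : cont_on ((cube n `*` setT) `*` setT) K.
  apply: cont_on_paste; first by cont.
  - apply: (cont_on_comp cPhi).
      by cont.
    by move=> [[d c] v] [_ /= h]; split => //=; rewrite nq.
  - apply: (cont_on_comp cH).
      cont; apply: cont_on_dir; last by cont.
      by move=> [[d c] v] [_ /= h]; exact: pos h.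
    move=> [[d c] v] [_ /= h]; split => //; split => //=; apply: norm_dir.
    exact: pos h.
  - move=> [[d c] v] _ /= E; rewrite E subrr H0'; last first.
      by apply: norm_dir; apply: (pos _ v); rewrite E.
    rewrite -(dirZ d (q0 v)) dir_id //.
    by rewrite nq.
have Kout d c v : `|d| = 1 -> K (d, c, v) = H (d, c, clamp v).
  move=> d1; rewrite /K /= d1 mulr1 dir_id // (_ : 1 + clamp v - 1 = clamp v); last by ring.
  case: ifP => // h; have -> : clamp v = 0 by have := q1 v; lra.
  by rewrite addr0 scale1r H0'.
have KY1 d b v : `|d| <= 1 -> chunk_mid (K (d, (b, circle_base), v)).
  move=> d1; rewrite /K /=; case: ifPn => [h|].
    by right; exists ((1 + clamp v) *: d, b) => //; split => //=; rewrite nq.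
  rewrite -ltNge => h; left; apply: HY; split => //=; apply: norm_dir.
  by apply: (pos _ v); exact: ltW.
pose p1 : 'rV[R]_n := const_mx 1.
have np1 : `|p1| = 1 by exact: rV_norm_const1.
have clamp1E : clamp (1 : R) = 1 by exact: clamp1.
have clamp0E : clamp (0 : R) = 0 by exact: clamp0.
(* At time 1 the circle coordinate may be replaced by the base point: where the tail is on the
   boundary the value is [y0] for every circle coordinate, and where the head is 1 or -1 the circle
   coordinate is the base point already. *)
apply: (@htp_trans _ _ _ _ _ (fun p => K (row_tl p.1, (p.2, circle_base), 1))).
- exists (fun p => K (row_tl p.1.1, (p.1.2, circle_map (row_hd p.1.1)), p.2)); split.
  +     apply: (cont_on_comp cK).
      cont; first by apply: cont_on_row_tl; cont.
      apply: cont_on_compc; first exact: continuous_circle_map.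
      by apply: cont_on_row_hd; cont.
    by move=> [[x b] v] [[/= /norm_split_eq1[_ t1 _] _] _].
  + move=> [x b] v [/= /norm_split_eq1[h1 t1 [h|t]] _].
      by rewrite circle_map_bd //; exact: KY1.
    by rewrite Kout //; left; exact: HY.
  + move=> [x b] [/= /norm_split_eq1[_ t1 _] _].
    by rewrite /K /chunk_next /= clamp0E addr0 mul1r t1 scale1r.
  + move=> [x b] [/= /norm_split_eq1[h1 t1 [h|t]] _].
      by rewrite circle_map_bd.
    by rewrite !Kout // clamp1E !H1'.
(* Over the circle base point the whole cube stays in [chunk_mid], so the tail can slide to the
   boundary point [p1], where the value is [y0]. *)
- have nconv d v : `|d| <= 1 -> `|(1 - clamp v) *: d + clamp v *: p1| <= 1.
    move=> d1; have := clamp_ge0 v; have := clamp_le1 v => v1 v0.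
    apply: le_trans (ler_normD _ _) _; rewrite !normrZ np1.
    rewrite (ger0_norm v0) ger0_norm; last by lra.
    by nra.
  exists (fun p => K ((1 - clamp p.2) *: row_tl p.1.1 + clamp p.2 *: p1,
    (p.1.2, circle_base), 1)); split.
  +     apply: (cont_on_comp cK).
      by cont; apply: cont_on_row_tl; cont.
    move=> [[x b] v] [[/= /norm_split_eq1[_ t1 _] _] _]; split => //=; split => //=.
    exact: nconv.
  + by move=> [x b] v [/= /norm_split_eq1[_ t1 _] _]; apply: KY1; exact: nconv.
  + by move=> [x b] _ /=; rewrite clamp0E subr0 scale1r scale0r addr0.
  + move=> [x b] _ /=; rewrite clamp1E subrr scale0r add0r scale1r.
    by rewrite Kout // clamp1E H1'.
Qed.

End ChunkCircle.

(** The hypothesis on [B] is used twice, with cells of dimension [n] over the circle base point and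
    then [n.+1] for the rest. *)
Lemma chunkable_circle (B : topologicalType) :
  compact [set: B] -> chunkable B -> chunkable (B * circle R)%type.
Proof.
move=> cB gB T n m Y X Phi y0 hT n0 aX Yy0 nPhi sY.
have sY1 : spherical (R := R) m.+1 (chunk_mid (Y := Y) (Phi := Phi)).
  apply: (gB _ _ _ _ _ _ _ hT n0 (chunk_chunk_base aX) Yy0) => //.
  apply: (htp_pre (h := fun p => (p.1, (p.2, circle_base))) nPhi).
  by split; [cont|move=> ? []].
apply: (@spherical_weaken _ m.+2) => //.
have Yy0' : chunk_mid (Y := Y) (Phi := Phi) y0 by left.
have nPhi' := chunk_next_null aX n0 nPhi.
exact: (gB _ _ _ _ _ _ _ hT (ltn0Sn n) (chunk_chunk_next cB aX) Yy0' nPhi' sY1).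
Qed.

End Chunks.

(** * Polydiscs *)

Lemma cont_on_prod (T : topologicalType) (I : eqType) (K : I -> topologicalType)
    (A : set T) (F : T -> prod_topology K) :
  (forall i, cont_on A (fun x => F x i)) -> cont_on A F.
Proof.
move=> cF; apply: cvg_cont_on => x Ax; apply/cvg_sup => i U [_ [[W oW <-]] Wx WU].
have := cF i x Ax W (open_nbhs_nbhs (conj oW Wx)).
by apply: filterS => y h Ay; apply: WU; exact: h.
Qed.

Section Plane.
Context {R : realType}.

Definition one2 : 'rV[R]_2 := delta_mx ord0 ord0.

Definition vec2 (a b : R) : 'rV[R]_2 := \row_i (if i == ord0 then a else b).

Lemma vec2E0 a b : vec2 a b ord0 ord0 = a.
Proof. by rewrite mxE eqxx. Qed.

Lemma vec2E1 a b : vec2 a b ord0 ord_max = b.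
Proof. by rewrite mxE. Qed.

Lemma ord2P (i : 'I_2) : i = ord0 \/ i = ord_max.
Proof. by case: i => [[|[|]]] // ?; [left|right]; exact: val_inj. Qed.

Lemma eq_plane (v w : 'rV[R]_2) :
  v ord0 ord0 = w ord0 ord0 -> v ord0 ord_max = w ord0 ord_max -> v = w.
Proof. by move=> h0 h1; apply/rowP => i; case: (ord2P i) => ->. Qed.

Lemma sqn2E (v : 'rV[R]_2) : sqn v = v ord0 ord0 ^+ 2 + v ord0 ord_max ^+ 2.
Proof.
rewrite /sqn big_ord_recl big_ord_recl big_ord0 addr0.
by congr (_ + v _ _ ^+ 2); exact: val_inj.
Qed.

Lemma sqn_one2 : sqn one2 = 1.
Proof. by rewrite sqn2E !mxE !eqxx /= expr1n expr0n addr0. Qed.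

Lemma sqn_convex n (v w : 'rV[R]_n) (c : R) : 0 <= c <= 1 ->
  sqn v <= 1 -> sqn w <= 1 -> sqn ((1 - c) *: v + c *: w) <= 1.
Proof.
move=> /andP[c0 c1] v1 w1.
apply: (@le_trans _ _ ((1 - c) * sqn v + c * sqn w)); last by nra.
rewrite /sqn !mulr_sumr -big_split; apply: ler_sum => i _; rewrite !mxE.
have c1' : 0 <= 1 - c by lra.
rewrite -subr_ge0.
have -> : (1 - c) * v ord0 i ^+ 2 + c * w ord0 i ^+ 2 -
    ((1 - c) * v ord0 i + c * w ord0 i) ^+ 2 =
    c * (1 - c) * (v ord0 i - w ord0 i) ^+ 2 by ring.
apply: mulr_ge0; [exact: mulr_ge0|exact: sqr_ge0].
Qed.

Lemma cont_on_sqn (T : topologicalType) (A : set T) n (f : T -> 'rV[R]_n) :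
  cont_on A f -> cont_on A (fun x => sqn (f x)).
Proof. by move=> cf; rewrite /sqn; cont. Qed.

Lemma cont_on_vec2 (T : topologicalType) (A : set T) (f g : T -> R) :
  cont_on A f -> cont_on A g -> cont_on A (fun x => vec2 (f x) (g x)).
Proof.
move=> cf cg; apply: cont_on_row => i; case: (ord2P i) => ->.
  by apply: cont_on_eq cf => x _; rewrite vec2E0.
by apply: cont_on_eq cg => x _; rewrite vec2E1.
Qed.

(* The square is mapped onto the disc by (u, v) |-> (u, v sqrt (1 - u^2)):
   1 - |w|^2 = (1 - u^2) (1 - v^2), so boundary goes to boundary. *)
Definition disc_of_square (u v : R) : 'rV[R]_2 := vec2 u (v * Num.sqrt (1 - u ^+ 2)).

Lemma sqn_disc_of_square u v : `|u| <= 1 ->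
  sqn (disc_of_square u v) = 1 - (1 - u ^+ 2) * (1 - v ^+ 2).
Proof.
move=> u1; rewrite sqn2E vec2E0 vec2E1 exprMn sqr_sqrtr; first by ring.
by rewrite subr_ge0 -real_normK ?num_real // expr_le1.
Qed.

Definition cube_disc (x : 'rV[R]_(3 + 3)) (i : 'I_3) : 'rV[R]_2 :=
  disc_of_square (x ord0 (lshift 3 i)) (x ord0 (rshift 3 i)).

Lemma sqr_le1 (a : R) : `|a| <= 1 -> a ^+ 2 <= 1.
Proof. by move=> a1; rewrite -real_normK ?num_real // expr_le1. Qed.

Lemma sqr_lt1 (a : R) : `|a| < 1 -> a ^+ 2 < 1.
Proof. by move=> a1; rewrite -real_normK ?num_real // expr_lt1. Qed.

Lemma sqn_cube_disc_le x i : `|x| <= 1 -> sqn (cube_disc x i) <= 1.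
Proof.
move=> /(rV_norm_le _ ler01) h; rewrite sqn_disc_of_square //.
have := sqr_le1 (h (lshift 3 i)); have := sqr_le1 (h (rshift 3 i)); nra.
Qed.

Lemma sqn_cube_disc_lt x i : `|x| < 1 -> sqn (cube_disc x i) < 1.
Proof.
move=> /(rV_norm_lt _ ltr01) h; rewrite sqn_disc_of_square ?ltW //.
have := sqr_lt1 (h (lshift 3 i)); have := sqr_lt1 (h (rshift 3 i)); nra.
Qed.

Lemma sqn_cube_disc_bd x : `|x| = 1 -> exists i, sqn (cube_disc x i) = 1.
Proof.
move=> x1; have [i xi] := rV_norm_eq1 x1.
have h j : `|x ord0 j| <= 1 by move: j; apply/(rV_norm_le _ ler01); rewrite x1.
have xi2 : x ord0 i ^+ 2 = 1 by rewrite -real_normK ?num_real // xi expr1n.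
case: (split_ordP i) xi2 => j -> E; exists j; rewrite sqn_disc_of_square // E; ring.
Qed.

(** In the interior [u ^+ 2 < 1], so the factor [sqrt (1 - u ^+ 2)] can be cancelled. *)
Lemma cube_disc_inj x y : `|x| < 1 -> `|y| < 1 ->
  (forall i, cube_disc x i = cube_disc y i) -> x = y.
Proof.
move=> /(rV_norm_lt _ ltr01) x1 /(rV_norm_lt _ ltr01) y1 h; apply/rowP => k.
have hu i : x ord0 (lshift 3 i) = y ord0 (lshift 3 i).
  by have := congr1 (fun v : 'rV_2 => v ord0 ord0) (h i); rewrite !vec2E0.
case: (split_ordP k) => i ->; first exact: hu.
have := congr1 (fun v : 'rV_2 => v ord0 ord_max) (h i); rewrite !vec2E1 hu.
apply: mulIf; rewrite sqrtr_eq0 -ltNge subr_gt0; exact: sqr_lt1.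
Qed.

Definition join_row m n (a : 'I_m -> R) (b : 'I_n -> R) : 'rV[R]_(m + n) :=
  row_mx (\row_i a i) (\row_i b i).

Lemma join_rowl m n (a : 'I_m -> R) (b : 'I_n -> R) i :
  join_row a b ord0 (lshift n i) = a i.
Proof. by rewrite row_mxEl mxE. Qed.

Lemma join_rowr m n (a : 'I_m -> R) (b : 'I_n -> R) i :
  join_row a b ord0 (rshift m i) = b i.
Proof. by rewrite row_mxEr mxE. Qed.

Lemma disc_of_square_surj (w : 'rV[R]_2) : sqn w <= 1 ->
  exists p : R * R, [/\ `|p.1| <= 1, `|p.2| <= 1 & disc_of_square p.1 p.2 = w].
Proof.
rewrite sqn2E; set u := w ord0 ord0; set v := w ord0 ord_max => uv.
have u2 : u ^+ 2 <= 1 by have := sqr_ge0 v; lra.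
have u1 : `|u| <= 1 by rewrite -(expr_le1 (n := 2)) // real_normK ?num_real.
have [u0|u0] := eqVneq (1 - u ^+ 2) 0.
  exists (u, 0); split => //=; first by rewrite normr0.
  have v0 : v = 0 by apply/eqP; rewrite -sqrf_eq0; apply/eqP; have := sqr_ge0 v; lra.
  by apply: eq_plane; rewrite ?vec2E0 ?vec2E1 // mul0r -/v v0.
have s0 : 0 < 1 - u ^+ 2 by rewrite lt_neqAle eq_sym u0 subr_ge0.
have s0' : 0 < Num.sqrt (1 - u ^+ 2) by rewrite sqrtr_gt0.
exists (u, v / Num.sqrt (1 - u ^+ 2)); split => //=.
  rewrite -(expr_le1 (n := 2)) // real_normK ?num_real // expr_div_n.
  rewrite sqr_sqrtr; last exact: ltW.
  rewrite ler_pdivrMr // mul1r; lra.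
by apply: eq_plane; rewrite ?vec2E0 ?vec2E1 // divfK // gt_eqF.
Qed.

Lemma cube_disc_surj (a : 'I_3 -> 'rV[R]_2) : (forall i, sqn (a i) <= 1) ->
  exists2 x, `|x| <= 1 & forall i, cube_disc x i = a i.
Proof.
move=> a1; have /choice[p hp] := fun i => disc_of_square_surj (a1 i).
exists (join_row (fun i => (p i).1) (fun i => (p i).2)).
  apply/(rV_norm_le _ ler01) => k; case: (split_ordP k) => i ->.
    by rewrite join_rowl; case: (hp i).
  by rewrite join_rowr; case: (hp i).
by move=> i; rewrite /cube_disc join_rowl join_rowr; case: (hp i).
Qed.

Lemma cont_on_cube_disc (T : topologicalType) (A : set T) (f : T -> 'rV[R]_6) i :
  cont_on A f -> cont_on A (fun x => cube_disc (f x) i).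
Proof. by move=> cf; apply: cont_on_vec2; cont. Qed.

End Plane.

(* A relative homeomorphism from the cube of dimension 5, modulo its boundary,
   to the boundary of the product of three discs, modulo (1, 1, 1): follow
   kappa by a linear isomorphism sending its base point to (1, 1, 1), then
   rescale radially. *)
Section PolydiscBoundary.
Context {R : realType}.
Implicit Types (w : 'rV[R]_(3 + 3)) (x y : 'rV[R]_5).

(** Adding coordinate 0 to the first coordinates of the other two planes sends the base point of the
    sphere to (1, 1, 1). *)
Definition shear w (i : 'I_3) : 'rV[R]_2 :=
  vec2 (w ord0 (lshift 3 i) + (if i == ord0 then 0 else w ord0 ord0))
    (w ord0 (rshift 3 i)).

Lemma lshift0 : lshift 3 (ord0 : 'I_3) = ord0 :> 'I_6.
Proof. exact: val_inj. Qed.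

(** The scalar is built in so that [a = 0] gives a trivial kernel and [a > 0] compares points on a
    ray. *)
Lemma shear_inj w w' (a : R) : (forall i, shear w i = a *: shear w' i) ->
  w = a *: w'.
Proof.
move=> h.
pose sh (v : 'rV[R]_6) (i : 'I_3) := if i == ord0 then 0 else v ord0 ord0.
have h0 i : w ord0 (lshift 3 i) + sh w i = a * (w' ord0 (lshift 3 i) + sh w' i).
  have := congr1 (fun v : 'rV_2 => v ord0 ord0) (h i).
  by rewrite [X in _ = X]mxE !vec2E0.
have h1 i : w ord0 (rshift 3 i) = a * w' ord0 (rshift 3 i).
  have := congr1 (fun v : 'rV_2 => v ord0 ord_max) (h i).
  by rewrite [X in _ = X]mxE !vec2E1.
have w0 : w ord0 ord0 = a * w' ord0 ord0.
  by have := h0 ord0; rewrite /sh eqxx !addr0 lshift0.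
apply/rowP => k; rewrite [RHS]mxE; case: (split_ordP k) => i ->; last exact: h1.
have := h0 i; rewrite /sh; case: ifP => _; first by rewrite !addr0.
by rewrite w0 mulrDr => /addIr.
Qed.

Lemma shear_surj (a : 'I_3 -> 'rV[R]_2) : exists w, forall i, shear w i = a i.
Proof.
pose re i := a i ord0 ord0.
pose w := join_row (fun i => re i - (if i == ord0 then 0 else re ord0))
  (fun i => a i ord0 ord_max).
have w0 : w ord0 ord0 = re ord0.
  have := join_rowl (fun i => re i - (if i == ord0 then 0 else re ord0))
    (fun i => a i ord0 ord_max) ord0.
  by rewrite lshift0 eqxx subr0.
exists w => i; apply: eq_plane; rewrite ?vec2E0 ?vec2E1 ?join_rowr //.
by rewrite w0 join_rowl subrK.
Qed.

Lemma shear_base i : shear (delta_mx ord0 ord0) i = one2.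
Proof.
apply: eq_plane; rewrite ?vec2E0 ?vec2E1 !mxE ?eqxx //=.
have -> : (lshift 3 i == ord0 :> 'I_(3 + 3)) = (i == ord0) by rewrite -!val_eqE.
by case: (i == ord0); rewrite ?addr0 ?add0r.
Qed.

Lemma shearZ (a : R) w i : shear (a *: w) i = a *: shear w i.
Proof.
apply: eq_plane; rewrite [in RHS]mxE ?vec2E0 ?vec2E1 !mxE //.
by case: ifP; rewrite ?addr0 // mulrDr.
Qed.

(** The squared gauge of the product of three discs: dividing by its square root projects radially
    onto the boundary of the product. *)
Definition radius2 (z : 'I_3 -> 'rV[R]_2) : R :=
  Num.max (sqn (z ord0)) (Num.max (sqn (z (inord 1))) (sqn (z ord_max))).

Lemma ord3P (i : 'I_3) : [\/ i = ord0, i = inord 1 | i = ord_max].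
Proof.
by case: i => [[|[|[|]]]] // ?; [apply: Or31|apply: Or32|apply: Or33];
  apply: val_inj; rewrite //= inordK.
Qed.

Lemma radius2_ge z i : sqn (z i) <= radius2 z.
Proof. by case: (ord3P i) => ->; rewrite /radius2 !le_max lexx ?orbT. Qed.

Lemma radius2_eq z : exists i, radius2 z = sqn (z i).
Proof.
rewrite /radius2 /Num.max; case: ifP => _; last by exists ord0.
by case: ifP => _; [exists ord_max|exists (inord 1)].
Qed.

Lemma radius2P z (r : R) : (forall i, sqn (z i) <= r) -> (exists i, sqn (z i) = r) ->
  radius2 z = r.
Proof.
move=> h [i zi]; apply/le_anti/andP; split; last by rewrite -zi radius2_ge.
by have [j ->] := radius2_eq z.
Qed.

Definition polysphere x (i : 'I_3) : 'rV[R]_2 :=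
  (Num.sqrt (radius2 (shear (kappa x))))^-1 *: shear (kappa x) i.

Lemma radius_shear_gt0 w : w != 0 -> 0 < radius2 (shear w).
Proof.
move=> w0; rewrite lt_neqAle eq_sym; apply/andP; split; last first.
  exact: le_trans (sqn_ge0 _) (radius2_ge _ ord0).
apply: contra w0 => /eqP r0; apply/eqP.
rewrite (@shear_inj w 0 0) ?scale0r // => i; rewrite scale0r.
apply: sqn_eq0; apply/le_anti; rewrite sqn_ge0 andbT -r0; exact: radius2_ge.
Qed.

Lemma sphere_neq0 n (w : 'rV[R]_n.+1) : sphere R n w -> w != 0.
Proof.
rewrite /sphere /= => sw; apply/eqP => w0; move: sw; rewrite w0 big1.
  by move/esym/eqP; rewrite oner_eq0.
by move=> i _; rewrite mxE expr0n.
Qed.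

Lemma radius_kappa_gt0 x : 0 < radius2 (shear (kappa x)).
Proof. exact/radius_shear_gt0/sphere_neq0/kappa_sphere. Qed.

Lemma sqn_polysphere x i :
  sqn (polysphere x i) = sqn (shear (kappa x) i) / radius2 (shear (kappa x)).
Proof.
by rewrite sqnZ exprVn sqr_sqrtr ?ltW ?radius_kappa_gt0 // mulrC.
Qed.

Lemma sqn_polysphere_le x i : sqn (polysphere x i) <= 1.
Proof.
by rewrite sqn_polysphere ler_pdivrMr ?radius_kappa_gt0 // mul1r radius2_ge.
Qed.

Lemma polysphere_touch x : exists i, sqn (polysphere x i) = 1.
Proof.
have [i Ei] := radius2_eq (shear (kappa x)); exists i.
by rewrite sqn_polysphere -Ei divff // gt_eqF // radius_kappa_gt0.
Qed.

Lemma polysphere_bd x i : `|x| = 1 -> polysphere x i = one2.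
Proof.
move=> x1; rewrite /polysphere kappa_bd // shear_base.
rewrite (@radius2P _ 1) ?sqrtr1 ?invr1 ?scale1r //.
  by move=> j; rewrite shear_base sqn_one2.
by exists ord0; rewrite shear_base sqn_one2.
Qed.

(** An open ray from the origin meets the unit sphere only once. *)
Lemma shear_ray w w' (a : R) : sphere R 5 w -> sphere R 5 w' -> 0 < a ->
  (forall i, shear w i = a *: shear w' i) -> w = w'.
Proof.
rewrite /sphere /= -!/(sqn _) => sw sw' a0 /shear_inj E.
move: sw; rewrite E sqnZ sw' mulr1 => /eqP.
rewrite sqrf_eq1 => /orP[/eqP ->|/eqP a1]; first by rewrite scale1r.
by move: a0; rewrite a1 oppr_gt0 ltr10.
Qed.

Lemma polysphere_inj x y : `|x| < 1 -> `|y| < 1 ->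
  (forall i, polysphere x i = polysphere y i) -> x = y.
Proof.
move=> x1 y1 h; apply: kappa_inj => //.
have rx : 0 < Num.sqrt (radius2 (shear (kappa x))).
  by rewrite sqrtr_gt0 radius_kappa_gt0.
have ry : 0 < Num.sqrt (radius2 (shear (kappa y))).
  by rewrite sqrtr_gt0 radius_kappa_gt0.
apply: (shear_ray (kappa_sphere x) (kappa_sphere y) (divr_gt0 rx ry)) => i.
by rewrite -scalerA -[_^-1 *: shear _ i]/(polysphere y i) -h scalerA divff ?scale1r ?gt_eqF.
Qed.

Lemma polysphere_neq x : `|x| < 1 -> ~ (forall i, polysphere x i = one2).
Proof.
move=> x1 h; have rx : 0 < Num.sqrt (radius2 (shear (kappa x))).
  by rewrite sqrtr_gt0 radius_kappa_gt0.
have sb : sphere R 5 (delta_mx ord0 ord0) := set_mem (sphere_base_proof R 5).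
have : kappa x = delta_mx ord0 ord0.
  apply: (shear_ray (kappa_sphere x) sb rx) => i.
  by rewrite shear_base -(h i) scalerA divff ?scale1r ?gt_eqF.
move=> /(congr1 (fun v : 'rV_6 => v ord0 ord0)); apply/eqP.
by rewrite [X in _ == X]mxE !eqxx lt_eqF // kappa0_lt1.
Qed.

Lemma polysphere_surj (a : 'I_3 -> 'rV[R]_2) :
  (forall i, sqn (a i) <= 1) -> (exists i, sqn (a i) = 1) ->
  exists2 x, `|x| <= 1 & forall i, polysphere x i = a i.
Proof.
move=> a1 [i0 ai0]; have [w hw] := shear_surj a.
have w0 : sqn w != 0.
  apply/eqP => /sqn_eq0 w0; move: ai0; rewrite -hw w0 -(scale0r w) shearZ.
  by rewrite sqnZ expr0n mul0r => /esym/eqP; rewrite oner_eq0.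
have w0' : 0 < sqn w by rewrite lt_neqAle eq_sym w0 sqn_ge0.
(* Scales the preimage [w] of [a] to the unit sphere; the radial rescaling in [polysphere] then
   divides by [c] again. *)
pose c := (Num.sqrt (sqn w))^-1.
have c0 : 0 < c by rewrite invr_gt0 sqrtr_gt0.
have [|x x1 xw] := @cube_surj_sphere R 5 (c *: w) isT.
  rewrite /sphere /= -/(sqn _) sqnZ /c exprVn sqr_sqrtr ?ltW //.
  by rewrite mulVf.
exists x => // i; rewrite /polysphere xw.
have E j : shear (c *: w) j = c *: a j by rewrite shearZ hw.
rewrite (@radius2P _ (c ^+ 2)).
- by rewrite sqrtr_sqr gtr0_norm // E scalerA mulVf ?scale1r // gt_eqF.
- by move=> j; rewrite E sqnZ ler_piMr ?sqr_ge0.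
- by exists i0; rewrite E sqnZ ai0 mulr1.
Qed.

Lemma cont_on_shear (T : topologicalType) (A : set T) (f : T -> 'rV[R]_6) i :
  cont_on A f -> cont_on A (fun t => shear (f t) i).
Proof.
by move=> cf; apply: cont_on_vec2; last (by cont); case: (i == ord0); cont.
Qed.

Lemma cont_on_polysphere (T : topologicalType) (A : set T) (f : T -> 'rV[R]_5) i :
  cont_on A f -> cont_on A (fun t => polysphere (f t) i).
Proof.
move=> cf; have cs j : cont_on A (fun t => shear (kappa (f t)) j).
  by apply: cont_on_shear; exact: cont_on_kappa.
apply: cont_on_scale; last exact: cs.
apply: cont_onV; first by move=> t _; rewrite gt_eqF // sqrtr_gt0 radius_kappa_gt0.
apply: cont_on_sqrt; apply: cont_on_max; first exact: cont_on_sqn.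
by apply: cont_on_max; exact: cont_on_sqn.
Qed.

End PolydiscBoundary.

(** * The filtration of the moment-angle complex *)

Section Stages.
Context {R : realType}.

Notation plane := ('rV[R]_2).
Notation amb := (prod_topology (fun _ : 'I_6 => 'rV[R]_2)).

Definition lo (i : 'I_3) : 'I_6 := lshift 3 i.
Definition hi (i : 'I_3) : 'I_6 := rshift 3 i.

Lemma lohiP (j : 'I_6) : (exists i, j = lo i) \/ (exists i, j = hi i).
Proof. by case: (@split_ordP 3 3 j) => i ->; [left|right]; exists i. Qed.

Definition point_of (a b : 'I_3 -> plane) : amb :=
  fun j => match @fintype.split 3 3 j with inl i => a i | inr i => b i end.

Lemma point_lo a b i : point_of a b (lo i) = a i.
Proof. by rewrite /point_of -[lo i]/(unsplit (inl i)) unsplitK. Qed.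

Lemma point_hi a b i : point_of a b (hi i) = b i.
Proof. by rewrite /point_of -[hi i]/(unsplit (inr i)) unsplitK. Qed.

Lemma point_eq a b (x : amb) :
  (forall i, a i = x (lo i)) -> (forall i, b i = x (hi i)) -> point_of a b = x.
Proof.
move=> ha hb; apply: functional_extensionality_dep => j.
by case: (lohiP j) => -[i ->]; rewrite ?point_lo ?point_hi.
Qed.

Lemma cont_on_point (T : topologicalType) (A : set T) (a b : T -> 'I_3 -> plane) :
  (forall i, cont_on A (fun t => a t i)) -> (forall i, cont_on A (fun t => b t i)) ->
  cont_on A (fun t => point_of (a t) (b t)).
Proof.
move=> ca cb; apply: cont_on_prod => j; case: (lohiP j) => -[i ->].
  by apply: cont_on_eq (ca i) => t _; rewrite point_lo.
by apply: cont_on_eq (cb i) => t _; rewrite point_hi.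
Qed.

Lemma cont_on_component (T : topologicalType) (A : set T) (f : T -> amb) j :
  cont_on A f -> cont_on A (fun t => f t j).
Proof.
apply: (@cont_on_compc _ _ _ A f (fun x : amb => x j)).
exact: (@proj_continuous _ (fun _ : 'I_6 => 'rV[R]_2) j).
Qed.

Lemma hausdorff_amb : hausdorff_space amb.
Proof.
apply: (@hausdorff_product _ (fun _ : 'I_6 => 'rV[R]_2)) => _.
exact: norm_hausdorff.
Qed.

Definition discs (x : amb) := forall j, sqn (x j) <= 1.

Definition touch (l : 'I_3 -> 'I_6) (x : amb) := exists i, sqn (x (l i)) = 1.

(** Coordinates [j], ..., 2 are frozen at 1, so [j = 0] gives a single point and [j = 3] the full
    torus. *)
Definition torus (l : 'I_3 -> 'I_6) (j : nat) (x : amb) :=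
  forall i : 'I_3, sqn (x (l i)) = 1 /\ ((j <= i)%N -> x (l i) = one2).

Definition flat (l : 'I_3 -> 'I_6) (x : amb) := forall i, x (l i) = one2.

(* Stage 0 0 is S x S u D x 1 u 1 x D; stage 3 3 is the moment-angle complex. *)
Definition stage (j k : nat) : set amb :=
  [set x | discs x /\ (touch lo x /\ touch hi x \/ torus hi j x \/ torus lo k x)].

Definition disc_wedge : set amb := [set x | discs x /\ (flat hi x \/ flat lo x)].

Lemma discs_point a b : (forall i, sqn (a i) <= 1) -> (forall i, sqn (b i) <= 1) ->
  discs (point_of a b).
Proof. by move=> a1 b1 j; case: (lohiP j) => -[i ->]; rewrite ?point_lo ?point_hi. Qed.

Definition contract (x : amb) (c : R) : amb :=
  fun j => (1 - c) *: x j + c *: one2.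

Lemma contract_disc_wedge x c : 0 <= c <= 1 -> disc_wedge x ->
  disc_wedge (contract x c).
Proof.
move=> c01 [x1 xf]; split.
  by move=> j; apply: sqn_convex => //; rewrite sqn_one2.
have E j : x j = one2 -> contract x c j = one2.
  by move=> xj; rewrite /contract xj -scalerDl subrK scale1r.
by case: xf => xf; [left|right] => i; exact: E.
Qed.

Definition onepoint : amb := fun=> one2.

Lemma disc_wedge_onepoint : disc_wedge onepoint.
Proof. by split; [move=> j; rewrite sqn_one2|left]. Qed.

Lemma contract0 x : contract x 0 = x.
Proof.
apply: functional_extensionality_dep => j.
by rewrite /contract subr0 scale1r scale0r addr0.
Qed.

Lemma contract1 x : contract x 1 = onepoint.
Proof.
apply: functional_extensionality_dep => j.
by rewrite /contract subrr scale1r scale0r add0r.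
Qed.

Lemma disc_wedge_null (T : topologicalType) (A : set T) (f : T -> amb) :
  maps A disc_wedge f -> htp R A disc_wedge f (fun=> onepoint).
Proof.
move=> [cf fW]; exists (fun p => contract (f p.1) (clamp p.2)); split => /=.
- apply: cont_on_prod => j; rewrite /contract; cont.
  by apply: (@cont_on_component _ _ (fun p => f p.1));
    apply: (cont_on_comp cf); [cont|move=> ? []].
- move=> x t /fW; apply: contract_disc_wedge.
  by rewrite clamp_ge0 clamp_le1.
- by move=> x _; rewrite clamp0 // contract0.
- by move=> x _; rewrite clamp1 // contract1.
Qed.

Lemma compact_disc_wedge : compact disc_wedge.
Proof.
have -> : disc_wedge =
    (fun x : 'rV[R]_6 => point_of (cube_disc x) (fun=> one2)) @` cube 6 `|`
    (fun x : 'rV[R]_6 => point_of (fun=> one2) (cube_disc x)) @` cube 6.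
  apply/seteqP; split => x.
    move=> [x1 [f|f]].
      have [y y1 yx] := cube_disc_surj (fun i => x1 (lo i)).
      by left; exists y => //; apply: point_eq.
    have [y y1 yx] := cube_disc_surj (fun i => x1 (hi i)).
    by right; exists y => //; apply: point_eq.
  move=> [[y y1 <-]|[y y1 <-]].
    split; last by left => i; rewrite point_hi.
    by apply: discs_point => i; [exact: sqn_cube_disc_le|rewrite sqn_one2].
  split; last by right => i; rewrite point_lo.
  by apply: discs_point => i; [rewrite sqn_one2|exact: sqn_cube_disc_le].
have cd i : cont_on (cube 6) (fun x : 'rV[R]_6 => cube_disc x i).
  by apply: cont_on_cube_disc; cont.
apply: compactU; (apply: continuous_compact; last exact: compact_cube);
  by apply/cont_onP; apply: cont_on_point => // i; exact: cont_on_cst.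
Qed.

Definition top_cell (x : 'rV[R]_(5 + 5)) : amb :=
  point_of (polysphere (lsubmx x)) (polysphere (rsubmx x)).

Lemma norm_sub_le (x : 'rV[R]_(5 + 5)) :
  `|x| <= 1 <-> `|lsubmx x| <= 1 /\ `|rsubmx x| <= 1.
Proof.
rewrite !(rV_norm_le _ ler01); split=> [h|[hl hr] i].
  by split => j; rewrite mxE; exact: h.
by case: (split_ordP i) => j ->; [have := hl j|have := hr j]; rewrite mxE.
Qed.

Lemma norm_sub_lt (x : 'rV[R]_(5 + 5)) :
  `|x| < 1 <-> `|lsubmx x| < 1 /\ `|rsubmx x| < 1.
Proof.
rewrite !(rV_norm_lt _ ltr01); split=> [h|[hl hr] i].
  by split => j; rewrite mxE; exact: h.
by case: (split_ordP i) => j ->; [have := hl j|have := hr j]; rewrite mxE.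
Qed.

Lemma torus0_flat l x : torus l 0 x <-> flat l x.
Proof.
split=> [h i|h i]; first by have [_] := h i; exact.
by rewrite h sqn_one2.
Qed.

Lemma top_cell_lo x i : top_cell x (lo i) = polysphere (lsubmx x) i.
Proof. exact: point_lo. Qed.

Lemma top_cell_hi x i : top_cell x (hi i) = polysphere (rsubmx x) i.
Proof. exact: point_hi. Qed.

(** The product of two cells of dimension 5, one for each factor S. Where one half is on its
    boundary, [polysphere] sends it to (1, 1, 1), so the boundary lands in the wedge. *)
Lemma attach_top_cell : attach disc_wedge (stage 0 0) top_cell.
Proof.
have dtop x : discs (top_cell x).
  by apply: discs_point => i; exact: sqn_polysphere_le.
split.
- exact: compact_disc_wedge.
- apply: cont_on_point => i; apply: cont_on_polysphere; apply: cont_on_row => j.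
    apply: (@cont_on_eq _ _ _ (fun x : 'rV[R]_(5 + 5) => x ord0 (lshift 5 j))); last by cont.
    by move=> x _; rewrite mxE.
  apply: (@cont_on_eq _ _ _ (fun x : 'rV[R]_(5 + 5) => x ord0 (rshift 5 j))); last by cont.
  by move=> x _; rewrite mxE.
- move=> x x1; split => //.
  have [l1 r1] : `|lsubmx x| <= 1 /\ `|rsubmx x| <= 1.
    by apply/norm_sub_le; rewrite x1.
  have [E|NE] := eqVneq `|lsubmx x| 1.
    by right => i; rewrite top_cell_lo polysphere_bd.
  left => i; rewrite top_cell_hi polysphere_bd //; apply/le_anti; rewrite r1 /= leNgt.
  apply/negP => r1'; suff : `|x| < 1 by rewrite x1 ltxx.
  by apply/norm_sub_lt; rewrite lt_neqAle NE l1.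
- move=> x y /norm_sub_lt[lx rx] /norm_sub_lt[ly ry] E.
  rewrite -[x]hsubmxK -[y]hsubmxK; congr row_mx; apply: polysphere_inj => // i.
    by have := congr1 (fun z : amb => z (lo i)) E; rewrite !top_cell_lo.
  by have := congr1 (fun z : amb => z (hi i)) E; rewrite !top_cell_hi.
- move=> x /norm_sub_lt[lx rx] [_ [f|f]].
    by apply: (polysphere_neq rx) => i; have := f i; rewrite top_cell_hi.
  by apply: (polysphere_neq lx) => i; have := f i; rewrite top_cell_lo.
- apply/seteqP; split => x.
    move=> [x1 [[row_tl th]|[/torus0_flat f|/torus0_flat f]]].
    + have [y y1 yx] := polysphere_surj (fun i => x1 (lo i)) row_tl.
      have [z z1 zx] := polysphere_surj (fun i => x1 (hi i)) th.
      right; exists (row_mx y z).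
        by apply/norm_sub_le; rewrite row_mxKl row_mxKr.
      by apply: point_eq => i; rewrite ?row_mxKl ?row_mxKr.
    + by left; split => //; left.
    + by left; split => //; right.
  move=> [[x1 [f|f]]|[y y1 <-]].
  + by split => //; right; left; apply/torus0_flat.
  + by split => //; right; right; apply/torus0_flat.
  + split => //; left; split.
      by have [i Ei] := polysphere_touch (lsubmx y); exists i; rewrite top_cell_lo.
    by have [i Ei] := polysphere_touch (rsubmx y); exists i; rewrite top_cell_hi.
Qed.

(** Compactness travels along because the next attachment requires it. *)
Definition compact_spherical (X : set amb) := compact X /\ spherical (R := R) 1 X.

Lemma compact_spherical_stage00 : compact_spherical (stage 0 0).
Proof.
split.
  rewrite (attach_eq attach_top_cell); apply: compactU; first exact: compact_disc_wedge.
  apply: continuous_compact; last exact: compact_cube.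
  by apply/cont_onP; exact: attach_cont attach_top_cell.
apply: (spherical_attach hausdorff_amb _ attach_top_cell disc_wedge_onepoint) => //.
  apply: disc_wedge_null; split.
    by apply: cont_on_sub (attach_cont attach_top_cell) => x /= ->.
  exact: attach_bd attach_top_cell.
apply: spherical_contractible disc_wedge_onepoint _.
by apply: disc_wedge_null; exact: maps_id.
Qed.

End Stages.

(** * Filling the tori one circle coordinate at a time *)

Section Steps.
Context {R : realType}.

Notation plane := ('rV[R]_2).
Notation amb := (prod_topology (fun _ : 'I_6 => 'rV[R]_2)).

(* B parametrises the subtorus where the coordinates j, ..., 2 are 1. *)
Record torus_param (j : nat) (B : topologicalType) (acc : B -> 'I_3 -> circle R) :
    Prop := TorusParam {
  tp_compact : compact [set: B];
  tp_chunkable : chunkable (R := R) B;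
  tp_cont : forall i, continuous (fun b => acc b i);
  tp_base : forall b (i : 'I_3), (j <= i)%N -> acc b i = circle_base;
  tp_inj : forall b c, (forall i, acc b i = acc c i) -> b = c;
  tp_surj : forall s : 'I_3 -> circle R,
    (forall i : 'I_3, (j <= i)%N -> s i = circle_base) ->
    exists b, forall i, acc b i = s i }.

Lemma torus_param0 : torus_param 0 (fun (_ : 'rV[R]_0) _ => circle_base).
Proof.
split.
- have -> : [set: 'rV[R]_0] = cube 0; last exact: compact_cube.
  by apply/seteqP; split => // x _ /=; rewrite [x]thinmx0 normr0.
- exact: chunkable_point.
- by move=> i; exact: cst_continuous.
- by [].
- by move=> b c _; rewrite [b]thinmx0 [c]thinmx0.
- by move=> s s0; exists 0 => i; rewrite s0.
Qed.

Lemma torus_paramS (j : 'I_3) (B : topologicalType) (acc : B -> 'I_3 -> circle R) :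
  torus_param j acc ->
  torus_param j.+1
    (fun (p : B * circle R) i => if i == j then p.2 else acc p.1 i).
Proof.
move=> [cB gB ca ba ia sa]; split.
- by have := compact_setX cB (@compact_circle R); rewrite setXTT.
- exact: chunkable_circle.
- move=> i; case: (i == j) => p; first exact: cvg_snd.
  by apply: (@continuous_comp _ _ _ fst (fun b => acc b i)); [exact: cvg_fst|exact: ca].
- move=> [b s] i ji /=; rewrite ifF; first by apply: ba; exact: ltnW.
  by apply/negbTE; apply: contraL ji => /eqP ->; rewrite -leqNgt.
- move=> [b s] [c t] /= h; have := h j; rewrite eqxx => ->; congr (_, _).
  apply: ia => i; have := h i; case: eqP => // -> _; by rewrite !ba.
- move=> s s0.
  (* Coordinate [j] is reset to the base point, which brings [s] into the range of [acc]; the new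
     circle factor restores it. *)
  have [|b hb] := sa (fun i => if i == j then circle_base else s i).
    move=> i ji; case: eqP => // /eqP ij; apply: s0.
    by rewrite ltn_neqAle ji andbT eq_sym.
  exists (b, s j) => i /=; case: eqP => [->//|/eqP ij].
  by rewrite hb (negbTE ij).
Qed.

Definition toward (c : R) (v : plane) : plane := (1 - c) *: v + c *: one2.

Lemma toward0 v : toward 0 v = v.
Proof. by rewrite /toward subr0 scale1r scale0r addr0. Qed.

Lemma toward1 v : toward 1 v = one2.
Proof. by rewrite /toward subrr scale1r scale0r add0r. Qed.

Lemma toward_one c : toward c one2 = one2.
Proof. by rewrite /toward -scalerDl subrK scale1r. Qed.

Lemma sqn_toward c v : 0 <= c <= 1 -> sqn v <= 1 -> sqn (toward c v) <= 1.
Proof. by move=> c01 v1; apply: sqn_convex => //; rewrite sqn_one2. Qed.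

Definition cval (s : circle R) : plane := val s.

Lemma sqn_cval s : sqn (cval s) = 1.
Proof. exact: set_mem (valP s). Qed.

Lemma cval_inj : injective cval.
Proof. exact: val_inj. Qed.

Lemma cval_surj v : sqn v = 1 -> exists s, cval s = v.
Proof. by move=> v1; exists (SigSub (mem_set (v1 : sphere R 1 v))). Qed.

Lemma continuous_cval : continuous cval.
Proof. exact: initial_continuous. Qed.

Section Step.
Context {j : 'I_3} {k : nat} {B : topologicalType} {acc : B -> 'I_3 -> circle R}.
Hypothesis tp : torus_param j acc.

(** Of the seven cell coordinates the head winds around circle [j]; the other six parametrise the
    three discs of the first factor. *)
Definition step_hi (c c' : R) (x : 'rV[R]_7) (b : B) (i : 'I_3) : plane :=
  if i == j then toward c (cval (circle_map (row_hd x)))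
  else toward c' (cval (acc b i)).

(* On the boundary of the cell either coordinate j of the torus point is
   already 1, or the disc coordinates lie in S; in both cases coordinate j can
   be moved to 1 first, then the disc coordinates, then the others. *)
Definition step_htp (p : 'rV[R]_7 * B * R) : amb :=
  point_of (fun i => toward (clamp (3 * p.2 - 1)) (cube_disc (row_tl p.1.1) i))
     (step_hi (clamp (3 * p.2)) (clamp (3 * p.2 - 2)) p.1.1 p.1.2).

Definition step_map (p : 'rV[R]_7 * B) : amb :=
  point_of (cube_disc (row_tl p.1)) (step_hi 0 0 p.1 p.2).

Lemma step_htp0 p : step_htp (p, 0) = step_map p.
Proof.
rewrite /step_htp /step_map /= mulr0 !sub0r !clamp0 ?oppr_le0 //.
by congr point_of; apply: funext => i; rewrite toward0.
Qed.

Lemma step_htp1 p : step_htp (p, 1) = onepoint.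
Proof.
rewrite /step_htp /= mulr1 !clamp1; [|lra..].
by apply: point_eq => i; rewrite ?toward1 // /step_hi !toward1 if_same.
Qed.

Lemma sqn_step_hi c c' x b i : 0 <= c <= 1 -> 0 <= c' <= 1 ->
  sqn (step_hi c c' x b i) <= 1.
Proof.
by move=> c1 c2; rewrite /step_hi; case: ifP => _; apply: sqn_toward;
  rewrite ?sqn_cval.
Qed.

Lemma torus_step (x : amb) : x (hi j) = one2 ->
  (forall i, i != j -> exists b, x (hi i) = cval (acc b i)) -> torus hi j x.
Proof.
move=> xj xi i; have [->|ij] := eqVneq i j; first by rewrite xj sqn_one2.
have [b ->] := xi i ij; rewrite sqn_cval; split => // ji.
by rewrite (tp_base tp).
Qed.

Lemma step_htp_stage x b u : `|x| = 1 -> stage j k (step_htp (x, b, u)).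
Proof.
move=> /norm_split_eq1[h1 t1 ht].
have c01 (t : R) : 0 <= clamp t <= 1 by rewrite clamp_ge0 clamp_le1.
rewrite /step_htp /=; split.
  apply: discs_point => i; last exact: sqn_step_hi.
  by apply: sqn_toward => //; exact: sqn_cube_disc_le.
(* In the first third only coordinate [j] moves. *)
have [u1|u1] := leP (3 * u) 1.
  have c2 : clamp (3 * u - 1) = 0 by apply: clamp0; lra.
  have c3 : clamp (3 * u - 2) = 0 by apply: clamp0; lra.
  case: ht => [h|t].
    right; left; apply: torus_step.
      by rewrite point_hi /step_hi eqxx circle_map_bd // toward_one.
    by move=> i ij; exists b; rewrite point_hi /step_hi (negbTE ij) c3 toward0.
  left; split.
    have [i Ei] := sqn_cube_disc_bd t.
    by exists i; rewrite point_lo c2 toward0.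
  (* A second circle coordinate keeps the point of the second factor in S while coordinate [j]
     leaves its circle. *)
  have [i ij] : exists i : 'I_3, i != j.
    by have [->|?] := eqVneq j ord0; [exists ord_max|exists ord0; rewrite eq_sym].
  by exists i; rewrite point_hi /step_hi (negbTE ij) c3 toward0 sqn_cval.
have c1 : clamp (3 * u) = 1 by apply: clamp1; exact: ltW.
(* In the second third coordinate [j] is 1, so the torus point lies in the filled subtorus and the
   discs are unconstrained. *)
have [u2|u2] := leP (3 * u) 2.
  have c3 : clamp (3 * u - 2) = 0 by apply: clamp0; lra.
  right; left; apply: torus_step.
    by rewrite point_hi /step_hi eqxx c1 toward1.
  by move=> i ij; exists b; rewrite point_hi /step_hi (negbTE ij) c3 toward0.
(* In the last third the discs are at 1 and coordinate [j] is 1, so both factors touch S whatever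
   the remaining coordinates do. *)
have c2 : clamp (3 * u - 1) = 1 by apply: clamp1; lra.
left; split; first by exists ord0; rewrite point_lo c2 toward1 sqn_one2.
by exists j; rewrite point_hi /step_hi eqxx c1 toward1 sqn_one2.
Qed.

Lemma cont_on_toward (T : topologicalType) (A : set T) (c : T -> R) (f : T -> plane) :
  cont_on A c -> cont_on A f -> cont_on A (fun t => toward (c t) (f t)).
Proof. by move=> cc cf; rewrite /toward; cont. Qed.

Lemma cont_on_step_hi (T : topologicalType) (A : set T) (c c' : T -> R)
    (f : T -> 'rV[R]_7) (g : T -> B) i :
  cont_on A c -> cont_on A c' -> cont_on A f -> cont_on A g ->
  cont_on A (fun t => step_hi (c t) (c' t) (f t) (g t) i).
Proof.
move=> cc cc' cf cg; rewrite /step_hi; case: (i == j).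
  apply: cont_on_toward => //; apply: (cont_on_compc continuous_cval).
  apply: (cont_on_compc continuous_circle_map); exact: cont_on_row_hd.
apply: cont_on_toward => //; apply: (cont_on_compc continuous_cval).
by apply: (@cont_on_compc _ _ _ A g (fun b => acc b i)); first exact: tp_cont tp i.
Qed.

Lemma cont_on_step_htp A : cont_on A step_htp.
Proof.
apply: cont_on_point => i.
  apply: cont_on_toward; first by cont.
  by apply: cont_on_cube_disc; apply: cont_on_row_tl; cont.
by apply: cont_on_step_hi; cont.
Qed.

Lemma cont_on_step_map A : cont_on A step_map.
Proof.
apply: cont_on_point => i; first by apply: cont_on_cube_disc; apply: cont_on_row_tl; cont.
by apply: cont_on_step_hi; cont.
Qed.

Lemma step_map_lo p i : step_map p (lo i) = cube_disc (row_tl p.1) i.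
Proof. exact: point_lo. Qed.

Lemma step_map_hij p : step_map p (hi j) = cval (circle_map (row_hd p.1)).
Proof. by rewrite /step_map point_hi /step_hi eqxx toward0. Qed.

Lemma step_map_hi p i : i != j -> step_map p (hi i) = cval (acc p.2 i).
Proof. by move=> ij; rewrite /step_map point_hi /step_hi (negbTE ij) toward0. Qed.

Lemma chunk_step : compact (stage (R := R) j k) ->
  chunk (stage j k) (stage j.+1 k) step_map.
Proof.
move=> cY; split => //.
- exact: cont_on_step_map.
- by move=> x b x1; rewrite -step_htp0; exact: step_htp_stage.
- move=> x y b c /norm_split_lt[hx tx] /norm_split_lt[hy ty] E; split.
    apply: row_split_eq.
      apply: circle_map_inj => //; apply: cval_inj.
      by have := congr1 (fun z : amb => z (hi j)) E; rewrite !step_map_hij.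
    apply: cube_disc_inj => // i.
    by have := congr1 (fun z : amb => z (lo i)) E; rewrite !step_map_lo.
  apply: (tp_inj tp) => i; have [->|ij] := eqVneq i j; first by rewrite !(tp_base tp).
  apply: cval_inj; have := congr1 (fun z : amb => z (hi i)) E.
  by rewrite !step_map_hi.
(* In the open cell all discs of the first factor are at interior points, which excludes the first
   and third alternatives of [stage]; coordinate [j] of the second factor is not 1, which excludes
   the second. *)
- move=> x b /norm_split_lt[hx tx] [_ [[[i]]|[]]].
  + by rewrite step_map_lo => h; have := sqn_cube_disc_lt i tx; rewrite h ltxx.
  + move=> /(_ j)[_ /(_ (leqnn _))]; rewrite step_map_hij.
    by move=> /(cval_inj (x2 := circle_base)); exact: circle_map_neq.
  + move=> /(_ ord0)[]; rewrite step_map_lo => h _.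
    by have := sqn_cube_disc_lt ord0 tx; rewrite h ltxx.
- apply/seteqP; split => x.
    move=> [x1 [t|[t|t]]]; [by left; split => //; left| |by left; split => //; right; right].
    have /choice[s hs] := fun i => cval_surj (proj1 (t i)).
    have [|b hb] := tp_surj tp (s := fun i => if i == j then circle_base else s i).
      move=> i ji; case: eqP => // /eqP ij; apply: cval_inj; rewrite hs.
      by apply: (proj2 (t i)); rewrite ltn_neqAle ji andbT eq_sym.
    have [e e1 es] := circle_map_surj (s j).
    have [d d1 dx] := cube_disc_surj (fun i => x1 (lo i)).
    right; exists (cons_row e d, b).
      by split => //=; apply/norm_split_le; rewrite row_hd_cons row_tl_cons.
    apply: functional_extensionality_dep => l; case: (lohiP l) => -[i ->].
      by rewrite step_map_lo /= row_tl_cons.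
    have [->|ij] := eqVneq i j; first by rewrite step_map_hij /= row_hd_cons es hs.
    by rewrite step_map_hi //= hb (negbTE ij) hs.
  move=> [[x1 [t|[t|t]]]|[[y b] [/= /norm_split_le[hy ty] _] <-]].
  + by split => //; left.
  + split => //; right; left => i; split; first exact: (proj1 (t i)).
    by move=> ji; apply: (proj2 (t i)); exact: ltnW.
  + by split => //; right; right.
  + split.
      apply: discs_point => i; first exact: sqn_cube_disc_le.
      by apply: sqn_step_hi; rewrite lexx ler01.
    right; left => i; have [->|ij] := eqVneq i j.
      by rewrite step_map_hij sqn_cval ltnn.
    rewrite step_map_hi // sqn_cval; split => // ji.
    by rewrite (tp_base tp) //; exact: ltnW.
Qed.

Lemma compact_spherical_step : compact_spherical (stage (R := R) j k) ->
  compact_spherical (stage (R := R) j.+1 k).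
Proof.
move=> [cY sY]; have aX := chunk_step cY; split.
  rewrite (chunk_eq aX); apply: compactU => //; apply: continuous_compact.
    by apply/cont_onP; exact: cont_on_step_map.
  by apply: compact_setX; [exact: compact_cube|exact: tp_compact tp].
have Y1 : stage j k (@onepoint R).
  split; first by move=> l; rewrite sqn_one2.
  by left; split; exists ord0; rewrite sqn_one2.
apply: (@spherical_weaken _ 2) => //.
apply: (tp_chunkable tp hausdorff_amb _ aX Y1) => //.
exists step_htp; split.
- exact: cont_on_step_htp.
- by move=> [x b] u [/= x1 _]; exact: step_htp_stage.
- by move=> p _; exact: step_htp0.
- by move=> p _; exact: step_htp1.
Qed.

End Step.

Lemma compact_spherical_steps k :
  compact_spherical (stage (R := R) 0 k) -> compact_spherical (stage (R := R) 3 k).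
Proof.
have tp1 := torus_paramS (j := ord0) torus_param0.
have tp2 := torus_paramS (j := Ordinal (isT : 1 < 3)%N) tp1.
move=> /(compact_spherical_step (j := ord0) torus_param0).
move=> /(compact_spherical_step (j := Ordinal (isT : 1 < 3)%N) tp1).
exact: (compact_spherical_step (j := Ordinal (isT : 2 < 3)%N) tp2).
Qed.

(** Swapping the factors reduces the filling of the second torus to that of the first. *)
Definition exchange (x : amb) : amb :=
  point_of (fun i => x (hi i)) (fun i => x (lo i)).

Lemma exchange_lo x i : exchange x (lo i) = x (hi i).
Proof. exact: point_lo. Qed.

Lemma exchange_hi x i : exchange x (hi i) = x (lo i).
Proof. exact: point_hi. Qed.

Lemma exchangeK : involutive exchange.
Proof. by move=> x; apply: point_eq => i; rewrite ?exchange_lo ?exchange_hi. Qed.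

Lemma exchange_stage j k x : stage j k x -> stage k j (exchange x).
Proof.
move=> [x1 xt]; split; first by apply: discs_point.
case: xt => [[[i ti] [i' ti']]|[t|t]].
- by left; split; [exists i'; rewrite exchange_lo|exists i; rewrite exchange_hi].
- by right; right => i; rewrite exchange_lo.
- by right; left => i; rewrite exchange_hi.
Qed.

Lemma continuous_exchange A : cont_on A exchange.
Proof.
by apply: cont_on_point => i; apply: (@cont_on_component R amb A id); exact: cont_on_id.
Qed.

Lemma compact_spherical_exchange j k :
  compact_spherical (stage (R := R) j k) -> compact_spherical (stage (R := R) k j).
Proof.
have mE j' k' : maps (stage j' k') (stage k' j') exchange.
  by split; [exact: continuous_exchange|exact: exchange_stage].
have hE j' k' : htp R (stage j' k') (stage j' k') (exchange \o exchange) id.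
  apply: htp_eq; first exact: maps_comp (mE j' k') (mE k' j').
  by move=> x _; exact: exchangeK.
move=> [cS sS]; split.
  have -> : stage k j = exchange @` stage j k.
    apply/seteqP; split => x; last by move=> [y /exchange_stage ? <-].
    by move=> /exchange_stage sx; exists (exchange x) => //; exact: exchangeK.
  apply: continuous_compact cS; apply/cont_onP; exact: continuous_exchange.
apply: spherical_heq sS; exists exchange, exchange.
by split.
Qed.

(** The indices pass through (0, 0), (3, 0), (0, 3) and (3, 3). *)
Lemma compact_spherical_stage33 : compact_spherical (stage (R := R) 3 3).
Proof.
apply: compact_spherical_steps; apply: compact_spherical_exchange.
apply: compact_spherical_steps.
exact: compact_spherical_stage00.
Qed.

End Steps.

(** * From subsets to subspaces, and the moment-angle complex as the last stage *)

Lemma cont_onT (T U : topologicalType) (f : T -> U) : cont_on setT f -> continuous f.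
Proof. by move=> cf x W /(cf x I); apply: filterS => y; apply. Qed.

Lemma cont_on_set_val (T : topologicalType) (A : set T) (B : set (set_type A)) :
  cont_on B (@set_val _ A).
Proof. by apply: continuous_cont_on; exact: initial_continuous. Qed.

(** [is_htp] keeps points in [A] at every real time, so [H] lifts to the subspace as a total
    function of time. *)
Lemma homotopy_equivalent_heq (R : realType) (T W : topologicalType) (A : set T) :
  heq R A [set: W] -> homotopy_equivalent R (set_type A) W.
Proof.
move=> [f [g [[cf _] [cg gA] [H [cH HA H0 H1]] [K [cK _ K0 K1]]]]].
pose f' (x : set_type A) : W := f (set_val x).
pose g' w : set_type A := SigSub (mem_set (gA w I)).
have valA (x : set_type A) : A (set_val x) by exact: set_valP.
have vI : injective (@set_val T A) by exact: val_inj.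
have cf' : continuous f'.
  apply: cont_onT; apply: (@cont_on_comp _ _ _ _ A _ f) => //.
  exact: cont_on_set_val.
have cg' : continuous g'.
  by apply: continuous_comp_initial; exact: cont_onT.
exists f', g'; split => //.
- exists (fun p : set_type A * R => SigSub (mem_set (HA _ p.2 (valA p.1)))); split.
  + apply: continuous_subspaceT; apply: continuous_comp_initial.
    apply: cont_onT; apply: (@cont_on_comp _ _ _ _ (A `*` setT)
      (fun p : set_type A * R => (set_val p.1, p.2)) H) => //.
      apply: cont_on_pair; last exact: cont_on_snd.
      apply: (@cont_on_compc _ _ _ _ fst); last exact: cont_on_fst.
      exact: initial_continuous.
    by move=> p _; split => //; exact: valA.
  + by move=> x; apply: vI; exact: (H0 _ (valA x)).
  + by move=> x; apply: vI; exact: (H1 _ (valA x)).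
- exists K; split.
  + by apply/cont_onP; apply: cont_on_sub cK => p _.
  + by move=> x; rewrite K0.
  + by move=> x; rewrite K1.
Qed.

Section MomentAngle.
Context {R : realType}.

Lemma mem_triangle123 (j : 'I_6) : (j \in triangle 1 2 3) = (j < 3)%N.
Proof.
rewrite !inE /vertex -!val_eqE /= !inordK //.
by case: j => [[|[|[|[|[|[|]]]]]]].
Qed.

Lemma mem_triangle456 (j : 'I_6) : (j \in triangle 4 5 6) = (2 < j)%N.
Proof.
rewrite !inE /vertex -!val_eqE /= !inordK //.
by case: j => [[|[|[|[|[|[|]]]]]]].
Qed.

Lemma lo_triangle i : (lo i \in triangle 1 2 3) * (lo i \in triangle 4 5 6 = false).
Proof.
have i3 : (lo i < 3)%N by exact: (ltn_ord i).
by rewrite mem_triangle123 mem_triangle456 i3 ltnNge -ltnS i3.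
Qed.

Lemma hi_triangle i : (hi i \in triangle 4 5 6) * (hi i \in triangle 1 2 3 = false).
Proof.
have i3 : (2 < hi i)%N by exact: (leq_addr i 3).
by rewrite mem_triangle123 mem_triangle456 i3 ltnNge i3.
Qed.

Lemma simplex_boundary_missing (S A : {set 'I_6}) :
  A \in simplex_boundary S -> A \subset S /\ exists2 j, j \in S & j \notin A.
Proof.
rewrite !inE => /andP[AS sAS]; split => //.
have /subsetPn[j jS jA] : ~~ (S \subset A).
  by apply: contra AS => SA; rewrite finset.eqEsubset sAS.
by exists j.
Qed.

Lemma simplex_boundaryD1 (S : {set 'I_6}) j : j \in S ->
  (S :\ j)%SET \in simplex_boundary S.
Proof.
move=> jS; rewrite !inE finset.subsetDl andbT; apply/eqP => E.
by have := jS; rewrite -E !inE eqxx.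
Qed.

(** A face of the join misses a vertex in each triangle, which puts a coordinate of each factor on
    its circle; a face of one triangle puts all coordinates of the other factor on their circles. *)
Lemma moment_angle_stage : moment_angle_set R complexK = stage 3 3.
Proof.
apply/seteqP; split => x.
  move=> [A /= KA [xd xs]]; split => //.
  move: KA; rewrite /complexK !finset.in_setU -orbA => /or3P[|AT|AT].
  - move=> /imset2P[C D /simplex_boundary_missing[CS [c cS cC]]].
    move=> /simplex_boundary_missing[DS [d dS dD]] E; left; split.
      case: (lohiP c) cS cC => -[i ->]; rewrite ?hi_triangle // => _ iC.
      exists i; apply: xs; rewrite E !inE negb_or iC /=.
      by apply/negP => /(fintype.subsetP DS); rewrite lo_triangle.
    case: (lohiP d) dS dD => -[i ->]; rewrite ?lo_triangle // => _ iD.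
    exists i; apply: xs; rewrite E !inE negb_or iD andbT.
    by apply/negP => /(fintype.subsetP CS); rewrite hi_triangle.
  - right; left => i; split; last by rewrite leqNgt ltn_ord.
    apply: xs; apply/negP; move: AT; rewrite finset.powersetE => /fintype.subsetP h /h.
    by rewrite hi_triangle.
  - right; right => i; split; last by rewrite leqNgt ltn_ord.
    apply: xs; apply/negP; move: AT; rewrite finset.powersetE => /fintype.subsetP h /h.
    by rewrite lo_triangle.
move=> [xd [[[i ti] [i' ti']]|[t|t]]].
(* The largest face of the join that omits the two coordinates known to be on the circle. *)
- exists ((triangle 1 2 3 :\ lo i) :|: (triangle 4 5 6 :\ hi i'))%SET.
    rewrite /= /complexK !finset.in_setU; apply/orP; left; apply/orP; left.
    by apply/imset2P; eexists; [| |reflexivity]; apply: simplex_boundaryD1;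
      rewrite ?lo_triangle ?hi_triangle.
  split => // j; case: (lohiP j) => -[l ->]; rewrite !inE.
    have := lo_triangle l; rewrite !inE => -[-> ->].
    by rewrite !andbF orbF andbT negbK => /eqP ->.
  have := hi_triangle l; rewrite !inE => -[-> ->].
  by rewrite !andbF andbT negbK => /eqP ->.
- exists (triangle 1 2 3).
    by rewrite /= /complexK !finset.in_setU !finset.powersetE fintype.subxx !orbT.
  split => // j; case: (lohiP j) => -[l ->]; first by rewrite lo_triangle.
  by move=> _; exact: (proj1 (t l)).
- exists (triangle 4 5 6).
    by rewrite /= /complexK !finset.in_setU !finset.powersetE fintype.subxx !orbT.
  split => // j; case: (lohiP j) => -[l ->]; last by rewrite hi_triangle.
  by move=> _; exact: (proj1 (t l)).
Qed.

End MomentAngle.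

Theorem proposition7p1 (R : realType) :
  exists (k : nat) (d : 'I_k.+1 -> nat),
    (forall i, 0 < d i)%N /\
    homotopy_equivalent R (moment_angle R complexK) (wedge_of_spheres R d).
Proof.
(* The lower bound of one sphere rules out the empty wedge, so the number of spheres is a
   successor. *)
have [_ [[|k] [d [// _ d0 h]]]] := @compact_spherical_stage33 R.
exists k, (fun i : 'I_k.+1 => d i); split; first by move=> i; exact: d0.
apply: homotopy_equivalent_heq; rewrite moment_angle_stage.
by have := h k d (leqnn _) (fun _ _ => erefl); rewrite wpart_full.
Qed.
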